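(* Let $\mu>0$ and $k_0,k_1\in\mathbb{R}$ be fixed. There exists a constant $C>0$ such that for any $\mathbf{u}\in\mathcal{W}$, $$\|\nabla\mathbf{u}\|^2_{L^2(\Omega)}\le C\|\mathbf{u}\|_{L^2(\Omega)}\|\nabla\mathbf{u}\|_{H^1(\Omega)}.$$
   Context: $\Omega:=\mathbb{R}\times(0,1)\subset\mathbb{R}^2$; $\mathbf{n}$ is the unit outer normal and $\tau$ a unit tangent vector on $\partial\Omega$; $\mathbb{D}(\mathbf{v})=\frac12(\nabla\mathbf{v}+\nabla^T\mathbf{v})$. The slip coefficient $k$ on $\partial\Omega$ is given by $k(x,1)=k_1$, $k(x,0)=k_0$. Set $\mathbf{V}:=\{\mathbf{v}\in H^1(\Omega)^2:\nabla\cdot\mathbf{v}=0,\ \mathbf{v}\cdot\mathbf{n}=0\text{ on }\partial\Omega\}$ and $\mathcal{W}:=\{\mathbf{v}\in\mathbf{V}\cap H^2(\Omega)^2: 2\mu\mathbb{D}(\mathbf{v})\mathbf{n}\cdot\tau=k(x,y)\mathbf{v}\cdot\tau\text{ on }\partial\Omega\}$. *)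

(* Defs.v *)
From HB Require Import structures.
From mathcomp Require Import all_boot all_order all_algebra.
From mathcomp Require Import all_classical all_reals all_analysis.

Set Implicit Arguments.
Unset Strict Implicit.
Unset Printing Implicit Defensive.
Import Order.TTheory GRing.Theory Num.Theory.
Import numFieldNormedType.Exports.

Local Open Scope classical_set_scope.
Local Open Scope ring_scope.

(* An element of L^2(Omega) is represented by a function on the whole plane,
   of which only the values in Omega matter. *)

Definition Omega {R : realType} : set (R * R) := [set p | 0 < p.2 < 1].

Definition leb2 (R : realType) :=
  (@lebesgue_measure R \x @lebesgue_measure R)%E.

Definition L2 (R : realType) (f : R * R -> R) : Prop :=
  f \_ Omega \in Lfun (@leb2 R) 2%:E.

Definition L2norm (R : realType) (f : R * R -> R) : \bar R :=
  ('N[@leb2 R]_2%:E[EFin \o (f \_ Omega)])%E.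

Definition ebase (R : realType) (i : 'I_2) : R * R :=
  if i == 0 then (1, 0) else (0, 1).

Fixpoint Ck (R : realType) (k : nat) (f : R * R -> R) : Prop :=
  continuous f /\
  if k is m.+1 then
    forall i : 'I_2, (forall p, derivable f p (ebase R i)) /\
                     Ck m ('D_(ebase R i) f)
  else True.

(* C_c^oo(U), for U open, as functions on the plane extended by zero *)
Definition test_function (R : realType) (U : set (R * R)) (phi : R * R -> R)
    : Prop :=
  (forall k, Ck k phi) /\
  exists K : set (R * R),
    [/\ compact K, K `<=` U & forall p, ~ K p -> phi p = 0].

Definition is_weakD (R : realType) (i : 'I_2) (f g : R * R -> R) : Prop :=
  L2 g /\
  forall phi, test_function Omega phi ->
    \int[@leb2 R]_(p in Omega) (f p * 'D_(ebase R i) phi p) =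
    - \int[@leb2 R]_(p in Omega) (g p * phi p).

(* A chosen representative of the weak derivative, which is unique up to
   equality a.e. in Omega; it is junk (zero) when f has no weak derivative in
   L^2(Omega). *)
Definition weakD (R : realType) (i : 'I_2) (f : R * R -> R) : R * R -> R :=
  xget (cst 0) [set g | is_weakD i f g].

Definition H1 (R : realType) (f : R * R -> R) : Prop :=
  L2 f /\ forall i : 'I_2, exists g, is_weakD i f g.

Definition H2 (R : realType) (f : R * R -> R) : Prop :=
  H1 f /\ forall i : 'I_2, H1 (weakD i f).

(* Tensor fields are families F of scalar fields indexed by a finite type I;
   norms are taken with respect to the pointwise Euclidean (Frobenius) norm. *)
Definition L2normv (R : realType) (I : finType) (F : I -> R * R -> R) : \bar R :=
  L2norm (fun p => Num.sqrt (\sum_i F i p ^+ 2)).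

Definition grad (R : realType) (I : finType) (F : I -> R * R -> R) :
  I * 'I_2 -> R * R -> R := fun ij => weakD ij.2 (F ij.1).

Definition H1normv (R : realType) (I : finType) (F : I -> R * R -> R) : \bar R :=
  ((L2normv F ^+ 2 + L2normv (grad F) ^+ 2) `^ 2^-1)%E.

(* The two components R x {0} and R x {1} of the boundary of Omega *)
Inductive side := bottom | top.

Definition height (R : realType) (s : side) : R :=
  match s with bottom => 0 | top => 1 end.

Definition normal (R : realType) (s : side) (i : 'I_2) : R :=
  match s with
  | bottom => if i == 0 then 0 else -1
  | top => if i == 0 then 0 else 1
  end.

(* The normal rotated by a quarter turn. The slip condition is linear in the
   tangent vector, so it does not depend on the orientation chosen here. *)
Definition tangent (R : realType) (s : side) (i : 'I_2) : R :=
  if i == 0 then - normal R s 1 else normal R s 0.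

Definition slip (R : realType) (k0 k1 : R) (s : side) : R :=
  match s with bottom => k0 | top => k1 end.

(* g is the trace of f in H^1(Omega) on the side s, the trace operator being
   the extension by continuity, from H^1(Omega) to L^2(R), of the restriction
   to the side of the functions in C_c^oo(R^2). *)
Definition has_trace (R : realType) (s : side) (f : R * R -> R) (g : R -> R)
    : Prop :=
  [/\ H1 f, g \in Lfun (@lebesgue_measure R) 2%:E &
  exists phi : nat -> R * R -> R,
  [/\ forall n, test_function setT (phi n),
      L2norm (phi n \- f) @[n --> \oo] --> 0%E,
      forall i : 'I_2,
        L2norm ('D_(ebase R i) (phi n) \- weakD i f) @[n --> \oo] --> 0%E &
      ('N[@lebesgue_measure R]_2%:E[
          EFin \o ((fun x => phi n (x, height R s)) \- g)%R])%E
        @[n --> \oo] --> 0%E]].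

Definition same_trace (R : realType) (s : side) (f1 f2 : R * R -> R) : Prop :=
  exists g, has_trace s f1 g /\ has_trace s f2 g.

Definition dot (R : realType) (a b : 'I_2 -> R) : R := \sum_i a i * b i.

Definition div (R : realType) (v : 'I_2 -> R * R -> R) (p : R * R) : R :=
  \sum_i weakD i (v i) p.

Definition strain (R : realType) (v : 'I_2 -> R * R -> R) (p : R * R)
    (i j : 'I_2) : R :=
  2^-1 * (weakD j (v i) p + weakD i (v j) p).

Definition V (R : realType) (v : 'I_2 -> R * R -> R) : Prop :=
  [/\ forall i, H1 (v i),
      {ae @leb2 R, forall p, Omega p -> div v p = 0} &
      forall s, has_trace s (fun p => dot (v ^~ p) (normal R s)) (cst 0)].

Definition W (R : realType) (mu k0 k1 : R) (v : 'I_2 -> R * R -> R) : Prop :=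
  [/\ V v, forall i, H2 (v i) &
      forall s,
        same_trace s
          (fun p => dot (fun i => 2 * mu * dot (strain v p i) (normal R s))
                        (tangent R s))
          (fun p => slip k0 k1 s * dot (v ^~ p) (tangent R s))].

(* Main.v *)
(* For w = D_i u, z = D_i w and s = 1 or -1, Taylor's formula with integral
   remainder reads
     w(p) = (s/h) (u(p + s h e_i) - u(p))
            - s int_0^h (1 - t/h) z(p + s t e_i) dt
   for a.e. p of the half strip 0 < y < 2/3 (s = 1) or 1/3 < y < 1 (s = -1),
   provided 0 < h <= 1/3. It is obtained by duality: tested against c (x) d, with
   c acting on the i-th coordinate, the right-hand side is moved onto
   psi = (1/h) int_0^h c(. - s t) dt and Phi = int_0^h (1 - t/h) c(. - s t) dt,
   which satisfy s Phi' = c - psi and s psi' = (c - c(. - s h))/h, so that the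
   weak formulations of w and z apply to psi (x) d and Phi (x) d.
   Hence |w|^2 <= 12 |u|^2 / h^2 + 6 h^2 |z|^2 in L^2(Omega), and choosing
   h^2 = |u| / |z|, or h = 1/3 if this is too large, gives the theorem. *)

From HB Require Import structures.
Require Import Defs.
From mathcomp Require Import all_boot all_order all_algebra.
From mathcomp Require Import all_classical all_reals all_analysis.
From mathcomp Require Import measurable_realfun ring lra.

Set Implicit Arguments.
Unset Strict Implicit.
Unset Printing Implicit Defensive.
Import Order.TTheory GRing.Theory Num.Theory.
Import numFieldNormedType.Exports.

Local Open Scope classical_set_scope.
Local Open Scope ring_scope.

(** * Smooth functions of one variable *)

(** Weak derivatives are visible only through test functions compactly supported in [Omega].
    Products are enough: smooth cutoffs of intervals converge to indicators of boxes, and a locally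
    integrable function whose integrals over all boxes vanish is zero almost everywhere. This is
    what turns the duality into an equality a.e. The obstacle is the boundary: a vertical shift must
    keep the enlarged support inside the strip, so the lower part is shifted upwards and the upper
    part downwards, while a horizontal shift meets no constraint. Functions are extended by zero, so
    that Fubini and translation invariance apply on the whole plane. Constants: squaring a sum of
    three terms costs 3; [u] occurs in two of them, which gives 6 for [u] and 3 for [z]; two
    overlapping strips double this to 12 and 6; summing over the two directions turns 12 into 24;
    balancing the two terms yields 24 + 6 = 30. *)

Section smooth.
Context {R : realType}.
Implicit Types (f g : R -> R) (n : nat).

(** The derivative is an existential witness, so closure proofs supply it explicitly and never
    compute a [derive1]. Level 0 asks nothing; continuity comes from level 1. *)
Fixpoint smoothn n f : Prop :=
  if n is m.+1 then
    exists g, (forall x : R, is_derive x 1 f (g x)) /\ smoothn m g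
  else True.

Definition smooth f := forall n, smoothn n f.

Lemma smoothnW n f : smoothn n.+1 f -> smoothn n f.
Proof.
elim: n f => [//|n IHn] f [g [fg sg]].
by exists g; split=> //; exact: IHn.
Qed.

Lemma smoothnD n f g : smoothn n f -> smoothn n g ->
  smoothn n (fun x => f x + g x).
Proof.
elim: n f g => [//|n IHn] f g [f' [ff' sf']] [g' [gg' sg']].
exists (fun x => f' x + g' x); split; last exact: IHn.
by move=> x; exact: is_deriveD.
Qed.

Lemma smoothnZ n (a : R) f : smoothn n f -> smoothn n (fun x => a * f x).
Proof.
elim: n f => [//|n IHn] f [f' [ff' sf']].
exists (fun x => a * f' x); split; last exact: IHn.
by move=> x; exact: is_deriveZ.
Qed.

Lemma smoothnM n f g : smoothn n f -> smoothn n g ->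
  smoothn n (fun x => f x * g x).
Proof.
elim: n f g => [//|n IHn] f g sf sg.
(* The product rule contains [f] and [g] themselves, so these are needed at level [n] too. *)
have := smoothnW sf; have := smoothnW sg.
move: sf sg => [f' [ff' sf']] [g' [gg' sg']] sg0 sf0.
exists (fun x => f x * g' x + g x * f' x); split.
  by move=> x; exact: is_deriveM.
by apply: smoothnD; exact: IHn.
Qed.

Lemma smoothn_affine n (a b : R) f : smoothn n f ->
  smoothn n (fun x => f (a * x + b)).
Proof.
elim: n f => [//|n IHn] f [f' [ff' sf']].
exists (fun x => a * f' (a * x + b)); split; last exact/smoothnZ/IHn.
move=> x; have axb : is_derive x 1 (fun x => a * x + b) a.
  apply: is_derive_eq; by rewrite addr0 /GRing.scale/= mulr1.
by rewrite mulrC; exact: is_derive1_comp.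
Qed.

Lemma smooth_affine (a b : R) f : smooth f -> smooth (fun x => f (a * x + b)).
Proof. by move=> sf n; exact: smoothn_affine. Qed.

Lemma smoothM f g : smooth f -> smooth g -> smooth (fun x => f x * g x).
Proof. by move=> sf sg n; exact: smoothnM. Qed.

Lemma smoothD f g : smooth f -> smooth g -> smooth (fun x => f x + g x).
Proof. by move=> sf sg n; exact: smoothnD. Qed.

Lemma smoothZ (a : R) f : smooth f -> smooth (fun x => a * f x).
Proof. by move=> sf n; exact: smoothnZ. Qed.

Lemma smooth_primitive f g : (forall x : R, is_derive x 1 f (g x)) ->
  smooth g -> smooth f.
Proof. by move=> fg sg [//|n]; exists g. Qed.

Lemma smooth_is_derive f (x : R) : smooth f -> is_derive x 1 f (derive1 f x).
Proof.
move=> /(_ 1%N)[g [/(_ x) fg _]].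
by apply: DeriveDef => //; rewrite derive1E.
Qed.

Lemma smooth_derive1 f : smooth f -> smooth (derive1 f).
Proof.
move=> sf n; have [g [fg sg]] := sf n.+1; rewrite (_ : derive1 f = g)//.
by apply/funext => x; rewrite derive1E; apply: derive_val.
Qed.

Lemma smooth_continuous f : smooth f -> continuous f.
Proof.
move=> sf x; apply/differentiable_continuous/derivable1_diffP.
by have := smooth_is_derive x sf; case.
Qed.

(** The difference quotient at [x] is at most [C |h|]. This serves at the point where the two
    branches of [flat] meet. *)
Lemma is_derive_quadratic_bound f (C : R) (x : R) : f x = 0 ->
  (forall y, `|f y| <= C * (y - x) ^+ 2) -> is_derive x 1 f 0.
Proof.
move=> fx0 fC.
have C0 : 0 <= C.
  by have := fC (x + 1); rewrite addrAC subrr add0r expr1n mulr1; apply: le_trans.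
suff fd : h^-1 *: ((f \o shift x) (h *: 1) - f x) @[h --> 0^'] --> (0 : R).
  by apply: DeriveDef; [apply: cvgP fd|exact: cvg_lim fd].
apply/cvgr0Pnorm_le => e e0.
near=> h.
have h0 : h != 0 by near: h; exact: nbhs_dnbhs_neq.
rewrite fx0 subr0 /= normrZ normrV ?unitfE// ler_pdivrMl ?normr_gt0//.
have := fC (h *: 1 + x); rewrite addrK => /le_trans; apply.
rewrite /GRing.scale/= mulr1 -real_normK ?num_real// expr2 mulrA mulrC.
rewrite ler_wpM2l//.
(* [C] may vanish, whereas [C + 1] can be divided by. *)
rewrite (@le_trans _ _ ((C + 1) * `|h|))//.
  by rewrite ler_wpM2r// lerDl.
rewrite -ler_pdivlMl ?ltr_wpDl//.
near: h; apply: dnbhs0_le; rewrite mulr_gt0// invr_gt0 ltr_wpDl//.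
Unshelve. all: by end_near. Qed.

(* [flat 0] is the flat function exp(-1/x); the family is closed under
   differentiation up to linear combinations. *)
Definition flat (k : nat) (x : R) : R :=
  if 0 < x then x^-1 ^+ k * expR (- x^-1) else 0.

(** With y = 1/x, one term of the exponential series gives e^y >= y^(k+2) / (k+2)!, hence y^k e^(-y)
    <= (k+2)! y^(-2). *)
Lemma flat_bound k (x : R) : `|flat k x| <= (k.+2)`!%:R * x ^+ 2.
Proof.
rewrite /flat; case: ifPn => x0; last by rewrite normr0 mulr_ge0// sqr_ge0.
have y0 : 0 < x^-1 by rewrite invr_gt0.
rewrite ger0_norm; last by rewrite mulr_ge0 ?expR_ge0// exprn_ge0// ltW.
rewrite expRN ler_pdivrMr ?expR_gt0//.
have := @expR_ge1Dxn _ (x^-1) k.+1 (ltW y0).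
set N := (k.+2)`!%:R; have N0 : 0 < N by rewrite ltr0n fact_gt0.
move=> H.
have {}H : x^-1 ^+ k.+2 <= N * expR x^-1.
  rewrite -ler_pdivrMl// mulrC; apply: le_trans H; by rewrite lerDr.
rewrite mulrAC (@le_trans _ _ (x^-1 ^+ k.+2 * x ^+ 2))//.
  rewrite -addn2 exprD -mulrA -exprMn mulVf ?gt_eqF//.
  by rewrite expr1n mulr1.
by rewrite ler_wpM2r// sqr_ge0.
Qed.

(** For x > 0 this is the product rule with (1/x)' = -1/x^2; for x < 0 the function is locally zero;
    at 0 the quadratic bound applies. *)
Lemma is_derive_flat k (x : R) :
  is_derive x 1 (flat k) (flat k.+2 x - k%:R * flat k.+1 x).
Proof.
have [x0|x0|->] := ltgtP x 0.
- rewrite {2 3}/flat ltNge (ltW x0)/= mulr0 subr0.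
  have : is_derive x 1 (cst 0 : R -> R) 0 by exact: is_derive_cst.
  apply: near_eq_is_derive => //; near=> y; rewrite /flat ifN// -leNgt ltW//.
  by near: y; exact: lt_nbhsl.
- have H : is_derive x 1 (fun x : R => x^-1 ^+ k * expR (- x^-1))
     (flat k.+2 x - k%:R * flat k.+1 x).
    have xn0 : x != 0 by rewrite gt_eqF.
    have dV : is_derive x 1 (fun x : R => x^-1) (- x ^- 2).
      have := @is_deriveV R (@id R) x 1 1 xn0 (is_derive_id _ _).
      by rewrite /GRing.scale/= mulr1.
    have dE : is_derive x 1 (fun x : R => expR (- x^-1)) (expR (- x^-1) * x ^- 2).
      have dN : is_derive x 1 (fun x : R => - x^-1) (x ^- 2).
        by have := is_deriveN dV; rewrite opprK.
      have dX : is_derive (- x^-1) 1 (@expR R) (expR (- x^-1)).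
        by exact: is_derive_expR.
      by have := @is_derive1_comp R (@expR R) (fun x => - x^-1) x _ _ dX dN.
    have H := @is_deriveM R _ _ _ _ _ _ _ (@is_deriveX R _ _ k _ _ _ dV) dE.
    move: H; rewrite exprfctE; set D := (_ + _) => H.
    suff <- : D = flat k.+2 x - k%:R * flat k.+1 x by [].
    rewrite /D /flat x0 /GRing.scale/= -!exprVn.
    case: (k) => [|m].
      rewrite expr0 /=; ring.
    rewrite /= !exprS; ring.
  apply: near_eq_is_derive H => //; near=> y; rewrite /flat ifT//.
  by near: y; exact: lt_nbhsr.
- rewrite {2 3}/flat ltxx mulr0 subr0.
  apply: (@is_derive_quadratic_bound _ (k.+2)`!%:R); first by rewrite /flat ltxx.
  by move=> y; rewrite subr0; exact: flat_bound.
Unshelve. all: by end_near. Qed.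

Lemma smooth_flat k : smooth (flat k).
Proof.
move=> n; elim: n k => [//|n IHn] k.
exists (fun x => flat k.+2 x + (- k%:R) * flat k.+1 x); split.
  by move=> x; rewrite mulNr; exact: is_derive_flat.
by apply: smoothnD => //; exact: smoothnZ.
Qed.

End smooth.

(** * Primitives and the two kernels of the duality argument *)

Section primitives.
Context {R : realType}.
Notation mu := (@lebesgue_measure R).
Implicit Types (c : R -> R).

Lemma is_derive_affine (f : R -> R) (a b x : R) :
  (forall y, f y = a * y + b) -> is_derive x 1 f a.
Proof.
move=> fE; rewrite (_ : f = fun y => a * y + b); last exact/funext.
by apply: is_derive_eq; rewrite addr0 /GRing.scale/= mulr1.
Qed.

(** Vanishing near -oo makes the integral from -oo converge and is inherited by the primitive, so
    the construction can be iterated. *)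
Lemma smooth_has_primitive c : smooth c ->
  (exists a, forall x, x <= a -> c x = 0) ->
  exists A, [/\ smooth A, forall x : R, is_derive x 1 A (c x) &
    exists a, forall x, x <= a -> A x = 0].
Proof.
move=> sc [a ca].
have cc := smooth_continuous sc.
have ic (u : R) : mu.-integrable `]-oo, u] (EFin \o c).
  have ic' : mu.-integrable `]-oo, u] ((EFin \o c) \_ `[a, u]).
    apply/integrable_restrict => //=.
    rewrite [X in mu.-integrable X _](_ : _ = `[a, u]%classic).
      apply: continuous_compact_integrable; first exact: segment_compact.
      exact: continuous_subspaceT.
    apply/seteqP; split=> x /=; rewrite !in_itv/=; first by case.
    by move=> /andP[ax xu]; split=> //; apply/andP.
  apply: eq_integrable ic' => // x; rewrite inE/= in_itv/= => xu.
  rewrite patchE; case: ifPn => //; rewrite notin_setE/= in_itv/= xu andbT.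
  by move/negP; rewrite -ltNge => xa; rewrite ca// ltW.
exists (fun x => \int[mu]_(t in `]-oo, x]) c t); have dA (x : R) :
    is_derive x 1 (fun x => \int[mu]_(t in `]-oo, x]) c t) (c x).
  have xx1 : x < x + 1 by rewrite ltrDl.
  have [dA eA] := @continuous_FTC1 R c -oo%O x (x + 1) xx1 (ic _) (ltNyr _) (cc x).
  by have := DeriveDef dA; rewrite -derive1E => /(_ _ eA).
split=> //; first exact: smooth_primitive dA sc.
exists a => x xa; rewrite (@eq_Rintegral _ _ _ _ _ (cst 0)).
  by rewrite Rintegral_cst// mul0r.
by move=> t; rewrite inE/= in_itv/= => tx; rewrite ca// (le_trans tx).
Qed.

Lemma smooth_FTC2 (f F : R -> R) (a b : R) : a < b -> continuous f ->
  (forall x : R, is_derive x 1 F (f x)) ->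
  \int[mu]_(x in `[a, b]) f x = F b - F a.
Proof.
move=> ab cf dF.
have cF : continuous F.
  move=> x; apply/differentiable_continuous/derivable1_diffP.
  by have := dF x; case.
rewrite /Rintegral (@continuous_FTC2 _ f F)//.
- exact: continuous_subspaceT.
- split.
  + by move=> x _; have := dF x; case.
  + exact: cvg_at_right_filter (cF a).
  + exact: cvg_at_left_filter (cF b).
- by move=> x _; rewrite derive1E; apply: derive_val.
Qed.

(** No differentiation under the integral sign: with P' = c and Q' = P, one has psi(y) = (s/h) (P(y)
    - P(y - s h)) and Phi(y) = s P(y) - (Q(y) - Q(y - s h)) / h, from which smoothness and both
    derivatives are read off. *)
Lemma smooth_kernel c (s h : R) : smooth c ->
  (exists a, forall x, x <= a -> c x = 0) -> s * s = 1 -> 0 < h ->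
  let Phi y := \int[mu]_(t in `[0, h]) ((1 - t / h) * c (y - s * t)) in
  let psi y := h^-1 * \int[mu]_(t in `[0, h]) c (y - s * t) in
  [/\ smooth Phi, forall y : R, is_derive y 1 Phi (s * (c y - psi y)),
      smooth psi &
      forall y : R, is_derive y 1 psi (s / h * (c y - c (y - s * h)))].
Proof.
move=> sc c0 ss h0 Phi psi.
have hn0 : h != 0 by rewrite gt_eqF.
have [P [sP dP P0]] := smooth_has_primitive sc c0.
have [Q [sQ dQ _]] := smooth_has_primitive sP P0.
have cc := smooth_continuous sc.
have cy y : continuous (fun t => c (y - s * t)).
  move=> t; apply: (@continuous_comp _ _ _ (fun t => y - s * t) c); last exact: cc.
  apply: cvgB; first exact: cvg_cst.
  by apply: cvgM; [exact: cvg_cst|exact: cvg_id].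
have dcomp (G g : R -> R) y (t : R) : (forall x : R, is_derive x 1 G (g x)) ->
    is_derive t 1 (fun t => G (y - s * t)) (- s * g (y - s * t)).
  move=> dG; have dl : is_derive t 1 (fun t => y - s * t) (- s).
    by apply: (@is_derive_affine _ _ y) => z; ring.
  have := @is_derive1_comp R G (fun t => y - s * t) t _ _ (dG _) dl.
  by rewrite mulrC.
have dsh (G g : R -> R) (y : R) : (forall x : R, is_derive x 1 G (g x)) ->
    is_derive y 1 (fun y => G (y - s * h)) (g (y - s * h)).
  move=> dG; have dl : is_derive y 1 (fun y => y - s * h) 1.
    by apply: (@is_derive_affine _ _ (- (s * h))) => z; ring.
  have := @is_derive1_comp R G (fun y => y - s * h) y _ _ (dG _) dl.
  by rewrite mulr1.
have ssh (G : R -> R) : smooth G -> smooth (fun y => G (y - s * h)).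
  move=> /(smooth_affine 1 (- (s * h))); congr smooth.
  by apply/funext => y; rewrite mul1r.
have psiE : psi = fun y => s / h * (P y - P (y - s * h)).
  apply/funext => y; rewrite /psi.
  have dF (t : R) : is_derive t 1 (fun t => - s * P (y - s * t)) (c (y - s * t)).
    have := @is_deriveZ R _ _ _ (- s) _ _ _ (dcomp _ _ y t dP).
    by rewrite /GRing.scale/= mulrA mulrNN ss mul1r.
  rewrite (smooth_FTC2 h0 (cy y) dF) mulr0 subr0; ring.
have PhiE : Phi = fun y => s * P y - h^-1 * (Q y - Q (y - s * h)).
  apply/funext => y; rewrite /Phi.
  have cky : continuous ((fun t => (1 - t / h) * c (y - s * t)) : R -> R).
    move=> t; apply: cvgM; last exact: cy.
    apply: cvgB; first exact: cvg_cst.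
    by apply: cvgM; [exact: cvg_id|exact: cvg_cst].
  (* Integration by parts in [t]: the [Q] term cancels what arises from differentiating the weight
     [1 - t / h]. *)
  have dF (t : R) : is_derive t 1 (fun t => - s * ((1 - t / h) * P (y - s * t)) +
                 h^-1 * Q (y - s * t)) ((1 - t / h) * c (y - s * t)).
    have dk : is_derive t 1 (fun t => 1 - t / h) (- h^-1).
      by apply: (@is_derive_affine _ _ 1) => z; ring.
    have H := @is_deriveD R _ _ _ _ _ _ _ _
      (@is_deriveZ R _ _ _ (- s) _ _ _
        (@is_deriveM R _ _ _ _ _ _ _ dk (dcomp _ _ y t dP)))
      (@is_deriveZ R _ _ _ (h^-1) _ _ _ (dcomp _ _ y t dQ)).
    apply: (is_derive_eq H).
    rewrite /GRing.scale/=.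
    rewrite -[c (y - s * t) in RHS]mul1r -ss; ring.
  rewrite (smooth_FTC2 h0 cky dF) mulr0 subr0 mulfV// mul0r subrr; ring.
have spsi : smooth psi.
  rewrite psiE; apply: smoothZ.
  have := smoothD sP (smoothZ (-1) (ssh _ sP)); congr smooth.
  by apply/funext => y; rewrite mulN1r.
have sPhi : smooth Phi.
  rewrite PhiE; have := smoothD (smoothZ s sP) (smoothZ (- h^-1)
    (smoothD sQ (smoothZ (-1) (ssh _ sQ)))); congr smooth.
  by apply/funext => y; rewrite mulN1r mulNr.
split=> // y.
- rewrite psiE PhiE.
  have H := @is_deriveB R _ _ _ _ _ _ _ _
    (@is_deriveZ R _ _ _ s _ _ _ (dP y))
    (@is_deriveZ R _ _ _ h^-1 _ _ _
      (@is_deriveB R _ _ _ _ _ _ _ _ (dQ y) (dsh _ _ y dQ))).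
  apply: (is_derive_eq H); rewrite /GRing.scale/=.
  transitivity (s * c y - s * s / h * (P y - P (y - s * h))); last by ring.
  by rewrite ss; ring.
- rewrite psiE.
  have H := @is_deriveZ R _ _ _ (s / h) _ _ _
      (@is_deriveB R _ _ _ _ _ _ _ _ (dP y) (dsh _ _ y dP)).
  exact: (is_derive_eq H).
Qed.

End primitives.

(** * Smooth cutoffs of an interval *)

Section cutoff.
Context {R : realType}.

Lemma flat0_itv (x : R) : 0 <= flat 0 x <= 1.
Proof.
rewrite /flat; case: ifPn => x0; last by rewrite lexx ler01.
rewrite expr0 mul1r expR_ge0/= -expR0 ler_expR oppr_le0 invr_ge0.
exact: ltW.
Qed.

Lemma flat_le0 k (x : R) : x <= 0 -> flat k x = 0.
Proof. by move=> x0; rewrite /flat ltNge x0. Qed.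

Lemma cvg_flat0 (a b : R) : 0 < a ->
  flat 0 (n.+1%:R * a - b) @[n --> \oo] --> (1 : R).
Proof.
move=> a0.
have cvgy : (n.+1%:R * a - b) @[n --> \oo] --> +oo.
  apply/cvgryPge => A; near=> n.
  rewrite lerBrDr -ler_pdivrMr//.
  apply: (@le_trans _ _ n%:R); last by rewrite ler_nat.
  by near: n; exact: nbhs_infty_ger.
have pos : \forall n \near \oo, 0 < n.+1%:R * a - b.
  by have /cvgryPgt/(_ 0) := cvgy.
suff : expR (- (n.+1%:R * a - b)^-1) @[n --> \oo] --> (1 : R).
  apply: cvg_trans; apply: near_eq_cvg; near=> n => /=.
  rewrite /flat ifT ?expr0 ?mul1r//.
  near: n; exact: pos.
have e0 : - (n.+1%:R * a - b)^-1 @[n --> \oo] --> (0 : R).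
  by rewrite -oppr0; apply: cvgN; apply/gtr0_cvgV0.
suff : expR (- (n.+1%:R * a - b)^-1) @[n --> \oo] --> expR (0 : R) by rewrite expR0.
by apply: continuous_cvg => //; exact: continuous_expR.
Unshelve. all: by end_near. Qed.

(** The [- 1] makes the function vanish within distance 1/(n+1) of the endpoints, so its support is
    compact inside the open interval; the factor n+1 drives both arguments to +oo, hence both values
    to 1, at interior points. *)
Definition cutoff (a b : R) (n : nat) (x : R) : R :=
  flat 0 (n.+1%:R * (x - a) - 1) * flat 0 (n.+1%:R * (b - x) - 1).

Lemma smooth_cutoff a b n : smooth (cutoff a b n).
Proof.
have := smoothM
  (smooth_affine n.+1%:R (- (n.+1%:R * a + 1)) (smooth_flat (R := R) 0))
  (smooth_affine (- n.+1%:R) (n.+1%:R * b - 1) (smooth_flat (R := R) 0)).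
congr smooth; apply/funext => x; rewrite /cutoff; congr (flat 0 _ * flat 0 _); ring.
Qed.

Lemma cutoff_itv a b n x : 0 <= cutoff a b n x <= 1.
Proof.
have /andP[f0 f1] := flat0_itv (n.+1%:R * (x - a) - 1).
have /andP[g0 g1] := flat0_itv (n.+1%:R * (b - x) - 1).
by rewrite /cutoff mulr_ge0//= mulr_ile1.
Qed.

Lemma cutoff_eq0 a b n x :
  ~ (x \in `[a + n.+1%:R^-1, b - n.+1%:R^-1]) -> cutoff a b n x = 0.
Proof.
move=> /negP; rewrite in_itv/= negb_and -!ltNge /cutoff => /orP[xa|xb].
- rewrite (@flat_le0 0 (n.+1%:R * (x - a) - 1)) ?mul0r// subr_le0.
  by rewrite -ler_pdivlMl ?ltr0n// mulr1 lerBlDl ltW.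
- rewrite (@flat_le0 0 (n.+1%:R * (b - x) - 1)) ?mulr0// subr_le0.
  by rewrite -ler_pdivlMl ?ltr0n// mulr1 lerBlDr addrC -lerBlDr ltW.
Qed.

Lemma cutoff_indic_le a b n x : cutoff a b n x <= \1_(`]a, b[) x.
Proof.
rewrite indicE; case: (boolP (x \in _)) => xab.
  by have /andP[] := cutoff_itv a b n x.
rewrite cutoff_eq0// => /[!in_itv]/= /andP[ax xb].
move: xab; rewrite notin_setE/= in_itv/=; apply.
have n0 : 0 < n.+1%:R^-1 :> R by rewrite invr_gt0.
rewrite (lt_le_trans _ ax) ?ltrDl//= (le_lt_trans xb)//.
by rewrite ltrBlDr ltrDl.
Qed.

Lemma cvg_cutoff a b x : cutoff a b n x @[n --> \oo] --> (\1_(`]a, b[) x : R).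
Proof.
rewrite indicE; case: (boolP (x \in _)) => xab.
  move: xab; rewrite inE/= in_itv/= => /andP[ax xb].
  by rewrite -[1%:R]mulr1; apply: cvgM; apply: cvg_flat0; rewrite subr_gt0.
rewrite (_ : (fun n => _) = cst 0); first exact: cvg_cst.
apply/funext => n; apply/eqP; rewrite eq_le.
have /andP[-> _] := cutoff_itv a b n x; rewrite andbT.
by have := cutoff_indic_le a b n x; rewrite indicE (negbTE xab).
Qed.

End cutoff.

(** * Tensor products as test functions *)

Section tensor.
Context {R : realType}.
Implicit Types (c d : R -> R) (i : 'I_2) (p : R * R).

(* [c] acts on the coordinate [i] and [d] on the other one *)
Definition tens i c d p : R := if i == 0 then c p.1 * d p.2 else d p.1 * c p.2.

Lemma tens_swap i c d : i != 0 -> tens i c d = tens 0 d c.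
Proof. by move=> i0; rewrite /tens (negbTE i0). Qed.

Lemma is_derive_tens i c d (c' : R -> R) p :
  (forall x : R, is_derive x 1 c (c' x)) ->
  is_derive p (ebase R i) (tens i c d) (tens i c' d p).
Proof.
move=> dc.
suff H : h^-1 *: ((tens i c d \o shift p) (h *: ebase R i) - tens i c d p)
    @[h --> 0^'] --> tens i c' d p.
  by apply: DeriveDef; [apply: cvgP H|exact: cvg_lim H].
have dcv x : h^-1 *: ((c \o shift x) (h *: 1) - c x) @[h --> 0^'] --> c' x.
  by have [dcx <-] := dc x; exact: dcx.
rewrite /tens /ebase; case: ifPn => _.
- apply: (cvg_trans _ (cvgM (dcv p.1) (cvg_cst (d p.2)))).
  apply: near_eq_cvg; near=> h.
  by rewrite /= /GRing.scale/= mulr0 add0r mulr1 -mulrA -mulrBl.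
- apply: (cvg_trans _ (cvgM (cvg_cst (d p.1)) (dcv p.2))).
  apply: near_eq_cvg; near=> h.
  rewrite /= /GRing.scale/= mulr0 add0r mulr1 -mulrBr; ring.
Unshelve. all: by end_near. Qed.

Lemma derive_tens i c d (c' : R -> R) :
  (forall x : R, is_derive x 1 c (c' x)) ->
  'D_(ebase R i) (tens i c d) = tens i c' d.
Proof.
by move=> dc; apply/funext => p; have [_ <-] := is_derive_tens i d p dc.
Qed.

Lemma continuous_tens i c d : continuous c -> continuous d ->
  continuous (tens i c d).
Proof.
move=> cc cd p.
have c1 (e : R -> R) : continuous e -> e q.1 @[q --> p] --> e p.1.
  by move=> ce; apply: (@continuous_comp _ _ _ fst e); [exact: cvg_fst|exact: ce].
have c2 (e : R -> R) : continuous e -> e q.2 @[q --> p] --> e p.2.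
  by move=> ce; apply: (@continuous_comp _ _ _ snd e); [exact: cvg_snd|exact: ce].
rewrite /tens; case: (eqVneq i 0) => _; first exact: (cvgM (c1 _ cc) (c2 _ cd)).
exact: (cvgM (c1 _ cd) (c2 _ cc)).
Qed.

Lemma Ck_tens k i c d : smooth c -> smooth d -> Ck k (tens i c d).
Proof.
have H c' d' : smooth c' -> smooth d' -> Ck k (tens 0 c' d').
  elim: k c' d' => [|k IHk] c' d' sc sd; split => //;
    try by apply: continuous_tens; exact: smooth_continuous.
  move=> j; have [->|j0] := eqVneq j 0.
    have dc (x : R) := smooth_is_derive x sc.
    split=> [p|]; first by have [] := is_derive_tens 0 d' p dc.
    rewrite (derive_tens _ _ dc); apply: IHk => //; exact: smooth_derive1.
  have dd (x : R) := smooth_is_derive x sd.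
  (* Read as [tens j d c], the product is differentiated through its first function again, so one
     derivative rule covers both directions. *)
  rewrite -(tens_swap _ _ j0).
  split=> [p|]; first by have [] := is_derive_tens j c' p dd.
  rewrite (derive_tens _ _ dd) tens_swap//; apply: IHk => //.
  exact: smooth_derive1.
move=> sc sd; have [->|i0] := eqVneq i 0; first exact: H.
by rewrite tens_swap//; exact: H.
Qed.

(** [Omega] is unbounded horizontally, so only the function of the second coordinate, which is [d]
    for [i = 0] and [c] otherwise, must be supported inside ]0, 1[. *)
Lemma test_function_tens i c d (a1 b1 a2 b2 : R) : smooth c -> smooth d ->
  (forall x, ~ (x \in `[a1, b1]) -> c x = 0) ->
  (forall x, ~ (x \in `[a2, b2]) -> d x = 0) ->
  (if i == 0 then 0 < a2 /\ b2 < 1 else 0 < a1 /\ b1 < 1) ->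
  test_function Omega (tens i c d).
Proof.
move=> sc sd c0 d0 ab; split; first by move=> k; exact: Ck_tens.
exists (if i == 0 then `[a1, b1] `*` `[a2, b2] else `[a2, b2] `*` `[a1, b1]).
move: ab; rewrite /tens; case: (eqVneq i 0) => _ [lo hi]; split.
- by apply: compact_setX; exact: segment_compact.
- move=> p [_ /=]; rewrite in_itv/= => /andP[ap pb]; rewrite /Omega/=.
  by rewrite (lt_le_trans lo)// (le_lt_trans pb).
- move=> p /not_andP[p1|p2]; first by rewrite c0// mul0r.
  by rewrite d0 ?mulr0.
- by apply: compact_setX; exact: segment_compact.
- move=> p [_ /=]; rewrite in_itv/= => /andP[ap pb]; rewrite /Omega/=.
  by rewrite (lt_le_trans lo)// (le_lt_trans pb).
- move=> p /not_andP[p1|p2]; first by rewrite d0// mul0r.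
  by rewrite c0 ?mulr0.
Qed.

End tensor.

(** * Shift invariance of the plane Lebesgue measure *)

Section leb2_sigma_finite.
Context {R : realType}.

(* [leb2] is a defined constant, on which the sigma-finiteness of product
   measures is not inferred *)
Let leb2_sigma_finite : sigma_finite setT (@leb2 R).
Proof.
have /sigma_finiteP[F [TF ndF Foo]] := sigma_finiteT (@lebesgue_measure R).
exists (fun n => F n `*` F n).
  rewrite -setXTT TF predeqE => -[x y]; split => [[/= [n _ Fnx] [k _ Fky]]|].
    exists (maxn n k) => //; split.
    - by move: x Fnx; exact/subsetPset/ndF/leq_maxl.
    - by move: y Fky; exact/subsetPset/ndF/leq_maxr.
  by move=> [n _ []/= ? ?]; split; exists n.
move=> k; have [mF Fy] := Foo k.
split; first exact: measurableX.
by rewrite /leb2 product_measure1E// lte_mul_pinfty// ge0_fin_numE.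
Qed.

HB.instance Definition _ :=
  Measure.copy (@leb2 R) ((@lebesgue_measure R \x @lebesgue_measure R)%E).

HB.instance Definition _ :=
  Measure_isSigmaFinite.Build _ _ R (@leb2 R) leb2_sigma_finite.

End leb2_sigma_finite.

Section shift.
Context {R : realType}.
Notation mu := (@lebesgue_measure R).
Notation lambda := (@leb2 R).

Lemma measurable_shift1 (t : R) :
  measurable_fun [set: measurableTypeR R] ((fun x => x + t) : _ -> measurableTypeR R).
Proof. exact: measurable_funD. Qed.

(** The pushforward agrees with Lebesgue measure on half-open intervals, which determine it. *)
Lemma lebesgue_measure_shift (t : R) (A : set (measurableTypeR R)) :
  measurable A ->
  pushforward mu ((fun x => x + t) : _ -> measurableTypeR R) A = mu A.
Proof.
move=> mA; apply/esym/lebesgue_measure_unique => //=.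
  exact: measurable_shift1.
move=> _ _ [[a b]] _ <-.
rewrite /pushforward.
have -> : (fun x : R => x + t) @^-1` `]a, b] = `]a - t, b - t]%classic.
  by apply/seteqP; split=> x /=; rewrite !in_itv/= ltrBlDr lerBrDr.
rewrite !lebesgue_measure_itv/= !lte_fin ltrD2r -!EFinB.
by congr (if _ then _%:E else _); ring.
Qed.

Lemma measurable_shift (v : R * R) :
  measurable_fun [set: measurableTypeR R * measurableTypeR R]
    ((fun p => p + v) : _ -> (measurableTypeR R * measurableTypeR R)%type).
Proof.
apply/measurable_fun_pairP; split; rewrite /comp/=.
  by apply: measurable_funD => //; exact: measurable_fst.
by apply: measurable_funD => //; exact: measurable_snd.
Qed.

(** A product measure is determined by rectangles, and on these the shift acts on each factor
    separately. *)
Lemma leb2_shift (v : R * R) (A : set (measurableTypeR R * measurableTypeR R)) :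
  measurable A -> 
  pushforward lambda
    ((fun p => p + v) : _ -> (measurableTypeR R * measurableTypeR R)%type) A =
  lambda A.
Proof.
move=> mA; apply/esym/product_measure_unique => //=.
  exact: measurable_shift.
move=> mv B C mB mC; rewrite /pushforward.
have -> : (fun p => p + v) @^-1` (B `*` C) =
    ((fun x => x + v.1) @^-1` B) `*` ((fun x => x + v.2) @^-1` C).
  by apply/seteqP; split.
rewrite /= /leb2 product_measure1E.
- by rewrite -(lebesgue_measure_shift v.1 mB) -(lebesgue_measure_shift v.2 mC).
- by rewrite -[X in measurable X]setTI; exact: measurable_shift1.
- by rewrite -[X in measurable X]setTI; exact: measurable_shift1.
Qed.

Lemma ge0_integral_shift (v : R * R) (f : R * R -> \bar R) :
  measurable_fun setT f -> (forall p, 0 <= f p)%E ->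
  (\int[lambda]_p f (p + v)%R = \int[lambda]_p f p)%E.
Proof.
move=> mf f0.
rewrite [RHS](eq_measure_integral (pushforward lambda
  ((fun p => p + v) : _ -> (measurableTypeR R * measurableTypeR R)%type))).
- exact: measurable_shift.
- move=> mv; rewrite ge0_integral_pushforward//.
- by move=> mv A mA _; exact/esym/leb2_shift.
Qed.

Lemma integral_shift (v : R * R) (f : R * R -> \bar R) :
  measurable_fun setT f ->
  (\int[lambda]_p f (p + v)%R = \int[lambda]_p f p)%E.
Proof.
move=> mf; rewrite [LHS]integralE [RHS]integralE.
have Hp := @ge0_integral_shift v (f^\+)%E (measurable_funepos mf)
  (fun p => funepos_ge0 f p).
have Hn := @ge0_integral_shift v (f^\-)%E (measurable_funeneg mf)
  (fun p => funeneg_ge0 f p).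
rewrite -Hp -Hn; congr (_ - _)%E; apply: eq_integral => p _.
  by rewrite !funeposE.
by rewrite !funenegE.
Qed.

End shift.

(** * Functions with vanishing integrals over boxes *)

(** Pi-lambda theorem for a signed measure; [nu setT = 0] takes care of complements. The map [f]
    allows one side of a rectangle to vary at a time ([fst], [snd]), and then general sets
    ([id]). *)
Lemma charge_preimage_eq0 d d' (T : measurableType d) (T' : measurableType d')
    (R : realType) (nu : {charge set T -> \bar R}) (f : T -> T')
    (G : set (set T')) : measurable_fun setT f ->
  @measurable _ T' = <<s G >> -> setI_closed G -> nu setT = 0%E ->
  (forall A, G A -> nu (f @^-1` A) = 0%E) ->
  forall A, measurable A -> nu (f @^-1` A) = 0%E.
Proof.
move=> mf GE GI nuT nuG A mA.
have mpre B : measurable B -> measurable (f @^-1` B).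
  by move=> mB; rewrite -[X in measurable X]setTI; exact: mf.
apply: (@dynkin_induction _ _ G (fun B => nu (f @^-1` B) = 0%E)) => //.
- move=> S mS nuS; 
  have -> : f @^-1` (~` S) = setT `\` f @^-1` S by rewrite setTD.
  rewrite chargeD//; last exact: mpre.
  by rewrite setTI nuT nuS sube0.
- move=> F mF tF nuF; rewrite preimage_bigcup.
  have H : trivIset setT (fun n => f @^-1` F n).
    apply/trivIsetP => i j _ _ ij; rewrite -preimage_setI.
    by move/trivIsetP : tF => /(_ i j Logic.I Logic.I ij) ->; rewrite preimage_set0.
  have := @charge_semi_sigma_additive _ _ _ nu _ (fun n => mpre _ (mF n)) H
    (bigcup_measurable (fun n _ => mpre _ (mF n))).
  rewrite (_ : (fun n => _) = cst 0%E); last first.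
    by apply/funext => n; rewrite big1.
  by move=> /cvg_lim <-//; rewrite lim_cst.
- by rewrite -GE.
Qed.

Section integral_box.
Context {R : realType}.
Notation lambda := (@leb2 R).
Notation mR := (measurableTypeR R).

(** Rays generate the Borel sets, are closed under intersection, and cut an open interval in an open
    interval. [setT] is added because the pi-lambda step also needs the total charge to vanish. *)
Let ray (A : set mR) := A = setT \/ exists x : R, A = `]x, +oo[%classic.

Let ray_measurableE : @measurable _ mR = <<s ray >>.
Proof.
rewrite eqEsubset; split => A.
  rewrite [X in X A -> _](RGenOInfty.measurableE R).
  apply: smallest_sub; first exact: smallest_sigma_algebra.
  by move=> I Ix; apply: sub_sigma_algebra; right.
apply: smallest_sub; first exact: sigma_algebra_measurable.
by move=> _ [->//|[x ->]]; exact: measurable_itv.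
Qed.

Let rayI : setI_closed ray.
Proof.
move=> A B [->|[x ->]]; first by rewrite setTI.
move=> [->|[y ->]]; first by rewrite setIT; right; exists x.
right; exists (Num.max x y); apply/seteqP; split=> z /=.
  by rewrite !in_itv/= !andbT gt_max => -[-> ->].
by rewrite !in_itv/= !andbT gt_max => /andP[].
Qed.

Let ray_measurable A : ray A -> measurable A.
Proof. by move=> [->//|[x ->]]; exact: measurable_itv. Qed.

(* The pi-lambda theorem is applied in one variable at a time. *)
Lemma integral_rays_eq0 (g : R * R -> \bar R) : lambda.-integrable setT g ->
  (forall A B, ray A -> ray B -> \int[lambda]_(p in A `*` B) g p = 0)%E ->
  forall A, measurable A -> (\int[lambda]_(p in A) g p = 0)%E.
Proof.
move=> ig gray.
pose nu := [the {charge set _ -> \bar R} of induced_charge ig].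
have step1 B : ray B -> forall A : set mR, measurable A -> nu (A `*` B) = 0%E.
  move=> rB A mA.
  have mD : measurable ([set: mR] `*` B).
    by apply: measurableX => //; exact: ray_measurable.
  have fstE A' : fst @^-1` A' `&` ([set: mR] `*` B) = A' `*` B.
    by apply/seteqP; split=> -[x y] /=; [case=> ? []|case].
  (* Once the charge is restricted to the band over [B], the rectangle over [A] and [B] becomes the
     preimage of [A] under [fst]. *)
  rewrite -fstE; apply: (@charge_preimage_eq0 _ _ _ _ _
   [the {charge set _ -> \bar R} of crestr nu mD] fst ray
   (@measurable_fst _ _ mR mR) ray_measurableE rayI) => //=.
    by rewrite /crestr setTI; apply: gray => //; left.
  by move=> A' rA'; rewrite /crestr fstE; exact: gray.
have step2 (A B : set mR) : measurable A -> measurable B -> nu (A `*` B) = 0%E.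
  move=> mA mB.
  have mD : measurable (A `*` [set: mR]) by exact: measurableX.
  have sndE B' : snd @^-1` B' `&` (A `*` [set: mR]) = A `*` B'.
    by apply/seteqP; split=> -[x y] /=; [case=> ? []|case].
  rewrite -sndE; apply: (@charge_preimage_eq0 _ _ _ _ _
   [the {charge set _ -> \bar R} of crestr nu mD] snd ray
   (@measurable_snd _ _ mR mR) ray_measurableE rayI) => //=.
    by rewrite /crestr setTI; apply: step1 => //; left.
  by move=> B' rB'; rewrite /crestr sndE; exact: step1.
move=> A mA; rewrite -[A]preimage_id.
apply: (@charge_preimage_eq0 _ _ _ _ _ nu id _ (@measurable_id _ _ _)
  (@measurable_prod_measurableType _ _ mR mR)) => //.
- move=> _ _ [X1 mX1 [X2 mX2 <-]] [Y1 mY1 [Y2 mY2 <-]].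
  rewrite -setXI; exists (X1 `&` Y1); first exact: measurableI.
  by exists (X2 `&` Y2) => //; exact: measurableI.
- by rewrite -setXTT; exact: step2.
- by move=> _ [X mX [Y mY <-]]; rewrite preimage_id; exact: step2.
Qed.

Let ray_itv (A : set mR) (a b : R) : ray A ->
  exists2 c, a <= c & A `&` `]a, b[ = `]c, b[%classic.
Proof.
move=> [->|[x ->]]; first by exists a => //; rewrite setTI.
exists (Num.max a x); first by rewrite le_max lexx.
apply/seteqP; split=> z /=; rewrite !in_itv/= gt_max andbT.
  by move=> [-> /andP[-> ->]].
by move=> /andP[/andP[-> ->] ->].
Qed.

(** [F] is integrable on bounded boxes only, so it is cut off to the box [U] of half-width [n]. The
    integral of the cut-off function over a product of rays is an integral of [F] over a smaller
    box, hence zero. Countably many [n] exhaust the band. *)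
Lemma ae_eq0_integral_box (F : R * R -> R) (a b : R) :
  (forall n : nat, lambda.-integrable (`]- n%:R, n%:R[ `*` `]a, b[) (EFin \o F)) ->
  (forall x1 x2 y1 y2, a <= y1 -> y2 <= b ->
    (\int[lambda]_(p in `]x1, x2[ `*` `]y1, y2[) (F p)%:E)%E = 0%E) ->
  {ae lambda, forall p, a < p.2 < b -> F p = 0}.
Proof.
move=> iF F0.
suff H n : {ae lambda, forall p, (`]- n%:R, n%:R[ `*` `]a, b[) p -> F p = 0}.
  have := ae_foralln H; apply: filterS => p Hp pab.
  have [n pn] : exists n : nat, `|p.1| < n%:R.
    by exists (Num.bound `|p.1|); exact: archi_boundP.
  apply: (Hp n); split => /=; rewrite !in_itv//=.
  by move: pn; rewrite ltr_norml.
pose U : set (mR * mR) := `]- n%:R, n%:R[ `*` `]a, b[.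
rewrite -/U.
have mU : measurable U by apply: measurableX; exact: measurable_itv.
have iFU : lambda.-integrable setT ((EFin \o F) \_ U).
  by apply/(integrable_mkcond _ mU); exact: iF.
have FU0 : forall A, measurable A ->
    (\int[lambda]_(p in A) ((EFin \o F) \_ U) p = 0)%E.
  apply: integral_rays_eq0 => // A B rA rB.
  rewrite -integral_mkcondr -setXI.
  have [c1 _ ->] := ray_itv (- n%:R) n%:R rA.
  have [c2 ac2 ->] := ray_itv a b rB.
  by apply: F0.
have := @integral_ae_eq _ _ _ lambda setT measurableT (cst 0%E) _ iFU
  (measurable_cst _).
move=> /(_ _)[|N [mN N0 sN]].
  by move=> E _ mE; rewrite FU0// integral0.
exists N; split=> // p /= nFp; apply: sN => /= H; apply: nFp => Up.
by have := H I; rewrite patchE mem_set// => -[].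
Qed.

End integral_box.

(** * Square-integrable functions *)

Section square_integrable.
Context d (T : measurableType d) (R : realType) (mu : {measure set T -> \bar R}).
Implicit Types f g : T -> R.

Definition sqn f : \bar R := (\int[mu]_x (f x ^+ 2)%:E)%E.

Definition sqint f := measurable_fun setT f /\ (sqn f < +oo)%E.

Lemma sqn_ge0 f : (0 <= sqn f)%E.
Proof. by apply: integral_ge0 => x _; rewrite lee_fin sqr_ge0. Qed.

Lemma measurable_sqr f : measurable_fun setT f ->
  measurable_fun setT (fun x => (f x ^+ 2)%:E).
Proof. by move=> mf; apply/measurable_EFinP; exact: measurable_funX. Qed.

Lemma Lnorm2_sqn f : ('N[mu]_2%:E[EFin \o f] ^+ 2 = sqn f)%E.
Proof.
have poweR2 (x : \bar R) : (0 <= x -> x ^+ 2 = x `^ 2)%E.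
  case: x => [r||]//; first by rewrite lee_fin => r0; rewrite poweR_EFin powR_mulrn.
  by rewrite poweRyr// expe2 mulyy.
rewrite poweR2 ?Lnorm_ge0//.
rewrite powR_Lnorm//; apply: eq_integral => x _ /=.
by rewrite powR_mulrn// real_normK// num_real.
Qed.

Lemma sqint_Lfun f : f \in Lfun mu 2%:E -> sqint f.
Proof.
rewrite inE => /andP[]; rewrite !inE/= => mf nf; split=> //.
by rewrite -Lnorm2_sqn expe2 lte_mul_pinfty ?Lnorm_ge0// ge0_fin_numE ?Lnorm_ge0.
Qed.

Lemma sqint_integrable f : sqint f ->
  mu.-integrable setT (fun x => (f x ^+ 2)%:E).
Proof.
move=> [mf nf]; apply/integrableP; split; first exact: measurable_sqr.
by under eq_integral do rewrite gee0_abs ?lee_fin ?sqr_ge0//.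
Qed.

(** The product is dominated by [f ^+ 2 + g ^+ 2]. *)
Lemma sqint_mul f g : sqint f -> sqint g ->
  mu.-integrable setT (EFin \o (f \* g)).
Proof.
move=> sf sg.
have ifg := integrableD measurableT (sqint_integrable sf) (sqint_integrable sg).
apply: le_integrable ifg => //.
  by apply/measurable_EFinP; apply: measurable_funM; [case: sf|case: sg].
move=> x _; rewrite /= lee_fin [leRHS]ger0_norm ?addr_ge0 ?sqr_ge0//.
rewrite ler_norml; apply/andP; split.
  have := sqr_ge0 (f x + g x); have := sqr_ge0 (f x); have := sqr_ge0 (g x); nra.
have := sqr_ge0 (f x - g x); have := sqr_ge0 (f x); have := sqr_ge0 (g x); nra.
Qed.

Lemma sqint_bounded_support f (D : set T) (M : R) : measurable D ->
  (mu D < +oo)%E -> measurable_fun setT f -> (forall x, `|f x| <= M) ->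
  (forall x, ~ D x -> f x = 0) -> sqint f.
Proof.
move=> mD fD mf fM f0; split=> //.
have : (\int[mu]_x ((M ^+ 2)%:E * (\1_D x)%:E) < +oo)%E.
  rewrite ge0_integralZl_EFin ?sqr_ge0//;
    last exact/measurable_EFinP/measurable_indic.
  rewrite integral_indic// setIT lte_mul_pinfty// ?lee_fin ?sqr_ge0//.
apply: le_lt_trans; apply: ge0_le_integral => //.
- by move=> x _; rewrite lee_fin sqr_ge0.
- exact: measurable_sqr.
- apply: emeasurable_funM => //.
  by apply/measurable_EFinP; exact: measurable_indic.
- move=> x _; rewrite -EFinM lee_fin indicE; case: (boolP (x \in D)).
    by rewrite mulr1 -(real_normK (num_real (f x))) lerXn2r ?nnegrE//
      (le_trans _ (fM x)).
  by rewrite notin_setE => nD; rewrite f0// expr0n mulr0.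
Qed.

Lemma sqint_integrable_fin f (D : set T) : measurable D -> (mu D < +oo)%E ->
  sqint f -> mu.-integrable D (EFin \o f).
Proof.
move=> mD fD sf; apply/(integrable_mkcond _ mD).
have s1 : sqint (\1_D : T -> R).
  apply: (@sqint_bounded_support _ D 1) => //.
  - by move=> x; rewrite indicE; case: (x \in D); rewrite ?normr1 ?normr0.
  - by move=> x nD; rewrite indicE memNset.
apply: eq_integrable (sqint_mul sf s1) => // x _.
by rewrite patchE /= indicE; case: ifPn; rewrite ?mulr1 ?mulr0.
Qed.

End square_integrable.

Section mean_inequality.
Context {R : realType}.
Notation mu := (@lebesgue_measure R).

(** Cauchy-Schwarz against the constant 1, with a right-hand side in [\bar R] so that it can be
    integrated by Tonelli before any finiteness is known. *)
Lemma sqr_Rintegral_le (g : R -> R) (h : R) : 0 < h ->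
  measurable_fun `[0, h] g ->
  (((\int[mu]_(t in `[0, h]) g t) ^+ 2)%R%:E <=
   h%:E * \int[mu]_(t in `[0%R, h]) (g t ^+ 2)%:E)%E.
Proof.
move=> h0 mg.
have mug : measurable_fun `[0, h] (fun t => (g t ^+ 2)%:E).
  by apply/measurable_EFinP; exact: measurable_funX.
(* If the right-hand side is infinite the bound is trivial; otherwise |g| <= 1 + g^2 makes [g]
   integrable. *)
have [goo|] := ltP (\int[mu]_(t in `[0%R, h]) (g t ^+ 2)%:E)%E +oo%E; last first.
  by rewrite leye_eq => /eqP ->; rewrite gt0_muley ?leey// lte_fin.
have ig2 : mu.-integrable `[0, h] (EFin \o (fun t => g t ^+ 2)).
  apply/integrableP; split => //.
  by under eq_integral do rewrite gee0_abs ?lee_fin ?sqr_ge0//.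
have ic (k : R) : mu.-integrable `[0, h] (EFin \o cst k).
  apply: continuous_compact_integrable; first exact: segment_compact.
  by apply: continuous_subspaceT => x; exact: cvg_cst.
have ig : mu.-integrable `[0, h] (EFin \o g).
  apply: le_integrable (integrableD _ (ic 1) ig2) => //.
    exact/measurable_EFinP.
  move=> t _; rewrite /= lee_fin [leRHS]ger0_norm ?addr_ge0 ?sqr_ge0//.
  have := sqr_ge0 (`|g t| - 1); rewrite -(real_normK (num_real (g t))).
  have := normr_ge0 (g t); nra.
set I := \int[mu]_(t in `[0, h]) g t; set J := \int[mu]_(t in `[0, h]) (g t ^+ 2).
have -> : (\int[mu]_(t in `[0%R, h]) (g t ^+ 2)%:E)%E = J%:E.
  by rewrite /J /Rintegral fineK// integrable_fin_num.
rewrite -EFinM lee_fin.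
(* integrate [2 m g <= g^2 + m^2] with [m] the mean of [g] *)
pose m := I / h.
have : \int[mu]_(t in `[0, h]) (2 * m * g t) <=
    \int[mu]_(t in `[0, h]) (g t ^+ 2 + m ^+ 2).
  apply: le_Rintegral => //.
  - exact: (@integrableZl _ _ _ mu _ (measurable_itv `[0, h]) (2 * m) _ ig).
  - exact: (@integrableD _ _ _ mu _ (measurable_itv `[0, h]) _ _ ig2 (ic (m ^+ 2))).
  - move=> t _; have := sqr_ge0 (g t - m); nra.
rewrite RintegralZl// RintegralD//; last exact: ic.
rewrite Rintegral_cst//= -/I -/J lebesgue_measure_itv/= lte_fin h0/= oppr0 addr0 /m.
have hn0 : h != 0 by rewrite gt_eqF.
have -> : 2 * (I / h) * I = 2 * (I ^+ 2 / h) by field.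
have -> : (I / h) ^+ 2 * h = I ^+ 2 / h by field.
move=> H; have : I ^+ 2 / h <= J by lra.
by rewrite ler_pdivrMr// mulrC.
Qed.

End mean_inequality.

(** * Averages along segments: measurability, norm bound, Fubini *)

Section average.
Context {R : realType}.
Notation mu := (@lebesgue_measure R).
Notation lambda := (@leb2 R).
Notation mR := (measurableTypeR R).
Implicit Types (z phi : R * R -> R) (i : 'I_2).

(* Remainder of Taylor's formula in the direction [s *: ebase R i]. *)
Definition average i (s h : R) z p : R :=
  \int[mu]_(t in `[0, h]) ((1 - t / h) * z (p + (s * t) *: ebase R i)).

Variables (i : 'I_2) (h : R).
Hypothesis h0 : 0 < h.

Lemma measurable_line (s : R) :
  measurable_fun [set: (mR * mR) * mR]
    ((fun q => q.1 + (s * q.2) *: ebase R i) : _ -> (mR * mR)%type).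
Proof.
have mc (c : R) : measurable_fun [set: (mR * mR) * mR] (fun q => (s * q.2) * c : R).
  by do 2 apply: measurable_funM => //; exact: measurable_snd.
have m11 : measurable_fun [set: (mR * mR) * mR] (fun q => q.1.1 : R).
  exact: (@measurableT_comp _ _ _ _ _ _ fst _ fst).
have m12 : measurable_fun [set: (mR * mR) * mR] (fun q => q.1.2 : R).
  exact: (@measurableT_comp _ _ _ _ _ _ snd _ fst).
apply/measurable_fun_pairP; split.
- exact: (measurable_funD m11 (mc (ebase R i).1)).
- exact: (measurable_funD m12 (mc (ebase R i).2)).
Qed.

(** The indicator replaces the domain of integration, which gives a function on the full product
    space, ready for Fubini. *)
Let kernel (s : R) z (q : R * R * R) : R :=
  \1_(`[0, h]) q.2 * ((1 - q.2 / h) * z (q.1 + (s * q.2) *: ebase R i)).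

Let measurable_indic_snd : measurable_fun [set: (mR * mR) * mR]
  (fun q => \1_(`[0, h]) q.2 : R).
Proof.
exact: (@measurableT_comp _ _ _ _ _ _ (\1_(`[0, h]) : mR -> R) _ snd).
Qed.

Let measurable_weight : measurable_fun [set: (mR * mR) * mR]
  (fun q => 1 - q.2 / h : R).
Proof.
by apply: measurable_funB => //; apply: measurable_funM => //; exact: measurable_snd.
Qed.

Let measurable_kernel s z : measurable_fun [set: mR * mR] z ->
  measurable_fun [set: (mR * mR) * mR] (kernel s z).
Proof.
move=> mz; apply: measurable_funM => //; apply: measurable_funM => //.
exact: (measurableT_comp mz (measurable_line s)).
Qed.

Let averageE s z p : average i s h z p = \int[mu]_t kernel s z (p, t).
Proof.
rewrite /average Rintegral_mkcond; apply: eq_Rintegral => t _.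
rewrite patchE /kernel indicE/=; case: ifPn; by rewrite ?mul1r ?mul0r.
Qed.

Lemma measurable_average s z : measurable_fun [set: mR * mR] z ->
  measurable_fun [set: mR * mR] (average i s h z).
Proof.
move=> mz; have mk := measurable_kernel s mz.
have -> : average i s h z = fine \o (fun p => \int[mu]_t (kernel s z (p, t))%:E)%E.
  by apply/funext => p /=; rewrite averageE.
apply: measurableT_comp => //.
have mk' : measurable_fun [set: (mR * mR) * mR] (EFin \o kernel s z).
  exact/measurable_EFinP.
(* Tonelli yields measurability for nonnegative integrands only, hence the splitting into positive
   and negative parts. *)
have -> : (fun p => \int[mu]_t (kernel s z (p, t))%:E)%E =
  ((fun p => \int[mu]_t ((EFin \o kernel s z)^\+ (p, t))) \-
   (fun p => \int[mu]_t ((EFin \o kernel s z)^\- (p, t))))%E.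
  apply/funext => p; rewrite [LHS]integralE; congr (_ - _)%E;
    apply: eq_integral => t _; by rewrite ?funeposE ?funenegE.
apply: emeasurable_funB.
  by apply: (@measurable_fun_fubini_tonelli_F _ _ _ _ _ mu);
    [exact: measurable_funepos|move=> q; exact: funepos_ge0].
by apply: (@measurable_fun_fubini_tonelli_F _ _ _ _ _ mu);
    [exact: measurable_funeneg|move=> q; exact: funeneg_ge0].
Qed.

(** Square of [z] along the segment. The weight [1 - t / h] lies in [0, 1] there and is dropped,
    which leaves a majorant that is easy to integrate. *)
Let sqline s z (q : R * R * R) : \bar R :=
  ((\1_(`[0, h]) q.2)%:E * (z (q.1 + (s * q.2) *: ebase R i) ^+ 2)%:E)%E.

Let sqline_ge0 s z q : (0 <= sqline s z q)%E.
Proof. by rewrite mule_ge0// lee_fin// sqr_ge0. Qed.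

Let measurable_sqline s z : measurable_fun [set: mR * mR] z ->
  measurable_fun [set: (mR * mR) * mR] (sqline s z).
Proof.
move=> mz; apply: emeasurable_funM; first exact/measurable_EFinP.
apply/measurable_EFinP/measurable_funX.
exact: (measurableT_comp mz (measurable_line s)).
Qed.

(** After Tonelli, translation invariance makes the integral over the plane independent of [t]; the
    factor [h] is the length of the segment. *)
Let integral_sqline s z : measurable_fun [set: mR * mR] z ->
  (\int[lambda]_p \int[mu]_t sqline s z (p, t) = h%:E * sqn lambda z)%E.
Proof.
move=> mz; have ms := measurable_sqline s mz.
transitivity (\int[mu]_t \int[lambda]_p sqline s z (p, t))%E.
  exact: (@fubini_tonelli _ _ _ _ R lambda mu (sqline s z) ms (sqline_ge0 s z)).
under eq_integral => t _.
  rewrite /sqline/= ge0_integralZl_EFin//; last 2 first.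
    by move=> p _; rewrite lee_fin sqr_ge0.
    apply/measurable_EFinP/measurable_funX.
    exact: (measurableT_comp mz (measurable_shift _)).
  rewrite (ge0_integral_shift _ (f := fun p => (z p ^+ 2)%:E))//; last 2 first.
    exact: measurable_sqr.
    by move=> p; rewrite lee_fin sqr_ge0.
  over.
rewrite /= ge0_integralZr//; last exact: sqn_ge0.
  rewrite integral_indic// setIT /= lebesgue_measure_itv/= lte_fin h0/=.
  by rewrite oppr0 adde0.
exact/measurable_EFinP/measurable_indic.
Qed.

Let measurable_zline s z p : measurable_fun [set: mR * mR] z ->
  measurable_fun [set: mR] (fun t : mR => z (p + (s * t) *: ebase R i)).
Proof.
move=> mz; have := measurableT_comp mz (measurable_line s).
by move=> /(measurable_fun_pair2 p).
Qed.

Lemma average_sqr_le s z p : measurable_fun [set: mR * mR] z ->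
  (((average i s h z p) ^+ 2)%R%:E <= h%:E * \int[mu]_t sqline s z (p, t))%E.
Proof.
move=> mz; have mzl := measurable_zline s p mz.
have mg : measurable_fun [set: mR]
    (fun t : mR => (1 - t / h) * z (p + (s * t) *: ebase R i)).
  apply: measurable_funM => //; apply: measurable_funB => //.
  exact: measurable_funM.
apply: le_trans (sqr_Rintegral_le h0 (measurable_funTS mg)) _.
rewrite lee_pmul2l// ?lte_fin//.
rewrite [leRHS](_ : _ = \int[mu]_(t in `[0%R, h])
    (z (p + (s * t) *: ebase R i)%R ^+ 2)%:E)%E; last first.
  rewrite [RHS]integral_mkcond; apply: eq_integral => t _.
  by rewrite patchE /sqline indicE/=; case: ifPn; rewrite ?mul1e ?mul0e.
apply: ge0_le_integral => //.
- by move=> t _; rewrite lee_fin sqr_ge0.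
- exact/measurable_EFinP/measurable_funX/measurable_funTS.
- exact/measurable_EFinP/measurable_funX/measurable_funTS.
- move=> t; rewrite /= in_itv/= => /andP[t0 th].
  rewrite lee_fin exprMn ler_piMl ?sqr_ge0//.
  have : 0 <= t / h <= 1 by rewrite divr_ge0 ?(ltW h0)//= ler_pdivrMr ?mul1r.
  move=> /andP[]; nra.
Qed.

(** One factor [h] comes from Cauchy-Schwarz on the segment, the other from [integral_sqline]. *)
Lemma sqn_average_le s z : measurable_fun [set: mR * mR] z ->
  (sqn lambda (average i s h z) <= (h ^+ 2)%:E * sqn lambda z)%E.
Proof.
move=> mz; rewrite expr2 EFinM -muleA -(integral_sqline s mz).
have ms := measurable_sqline s mz.
have mF := measurable_fun_fubini_tonelli_F (m2 := mu) _ ms (sqline_ge0 s z).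
rewrite -ge0_integralZl//; last 2 first.
- by move=> p _; exact: integral_ge0.
- by rewrite lee_fin ltW.
apply: ge0_le_integral => //.
- by move=> p _; rewrite lee_fin sqr_ge0.
- by apply: measurable_sqr; exact: measurable_average.
- by apply: measurable_funeM; exact: mF.
- by move=> p _; exact: average_sqr_le.
Qed.

Lemma sqint_average s z : sqint lambda z -> sqint lambda (average i s h z).
Proof.
move=> [mz nz]; split; first exact: measurable_average.
by rewrite (le_lt_trans (sqn_average_le s mz))// lte_mul_pinfty// lee_fin sqr_ge0.
Qed.

Let integrable_sqline s z : sqint lambda z ->
  (lambda \x mu)%E.-integrable setT (sqline s z).
Proof.
move=> [mz nz]; apply/integrable12ltyP; first exact: measurable_sqline.
under eq_integral => p _ do
  under eq_integral => t _ do rewrite gee0_abs//.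
by rewrite integral_sqline// lte_mul_pinfty// lee_fin ltW.
Qed.

Lemma integral_average s phi z : sqint lambda phi -> sqint lambda z ->
  \int[lambda]_p (phi p * average i s h z p) =
  \int[mu]_(t in `[0, h])
    ((1 - t / h) * \int[lambda]_p (phi p * z (p + (s * t) *: ebase R i))).
Proof.
move=> sphi sz; have [mphi _] := sphi; have [mz _] := sz.
pose H q := phi q.1 * kernel s z q.
have mH : measurable_fun [set: (mR * mR) * mR] H.
  apply: measurable_funM; last exact: measurable_kernel.
  by apply: (@measurableT_comp _ _ _ _ _ _ phi _ fst) => //; exact: measurable_fst.
have iH : (lambda \x mu)%E.-integrable setT (EFin \o H).
  (* For slope 0 the shift disappears, so [sqline 0 phi] is just [phi ^+ 2] for [t] in the segment;
     the majorant is a^2 + b^2 for the product a b. *)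
  apply: le_integrable (integrableD measurableT (integrable_sqline 0 sphi)
    (integrable_sqline s sz)) => //; first exact/measurable_EFinP.
  move=> q _; rewrite [leRHS]gee0_abs ?adde_ge0// /sqline /H /kernel.
  rewrite -!EFinM -EFinD lee_fin mul0r scale0r addr0.
  rewrite indicE; case: (boolP (q.2 \in _)) => [|_];
    last by rewrite !mul0r mulr0 addr0 normr0.
  rewrite inE/= in_itv/= => /andP[t0 th].
  have /andP[k0 k1] : 0 <= q.2 / h <= 1.
    by rewrite divr_ge0 ?(ltW h0)//= ler_pdivrMr ?mul1r.
  rewrite !mul1r mulrCA normrM ger0_norm ?subr_ge0//.
  apply: (@le_trans _ _ `|phi q.1 * z (q.1 + (s * q.2) *: ebase R i)|).
    by rewrite ler_piMl// gerBl.
  set a := phi _; set b := z _.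
  have := sqr_ge0 (a - b); have := sqr_ge0 (a + b); have := sqr_ge0 a.
  by have := sqr_ge0 b; rewrite ler_norml => ? ? ? ?; apply/andP; split; nra.
(* Only for almost every [p] is the kernel known to be integrable in [t], so that [phi p] may be
   taken out of the integral. *)
have inner : ae_eq lambda setT
    (fun p => (phi p * average i s h z p)%:E)
    (fun p => \int[mu]_t (H (p, t))%:E)%E.
  have := ae_integrable1 (integrable_sqline s sz).
  apply: filterS => p ip _.
  have ik : mu.-integrable setT (fun t => (kernel s z (p, t))%:E).
    have i1 : mu.-integrable setT (EFin \o (\1_(`[0, h]) : R -> R)).
      exact: integrable_indic_itv.
    apply: le_integrable (integrableD measurableT i1 ip) => //.
      apply/measurable_EFinP.
      exact: (measurable_fun_pair2 p (measurable_kernel s mz)).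
    move=> t _; rewrite /= lee_fin [leRHS]ger0_norm; last first.
      by rewrite addr_ge0// mulr_ge0// sqr_ge0.
    rewrite /kernel/= indicE; case: (boolP (t \in _)) => [|_];
      last by rewrite !mul0r addr0 normr0.
    rewrite inE/= in_itv/= => /andP[t0 th].
    have /andP[k0 k1] : 0 <= t / h <= 1.
      by rewrite divr_ge0 ?(ltW h0)//= ler_pdivrMr ?mul1r.
    rewrite !mul1r normrM (ger0_norm (x := 1 - _)) ?subr_ge0//.
    set b := z _; apply: (@le_trans _ _ `|b|); first by rewrite ler_piMl// gerBl.
    have := sqr_ge0 (`|b| - 1); rewrite -(real_normK (num_real b)).
    have := normr_ge0 b; nra.
  rewrite /H/=; under eq_integral do rewrite EFinM.
  rewrite integralZl// averageE EFinM /Rintegral fineK//.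
  exact: integrable_fin_num.
transitivity (fine (\int[lambda]_p \int[mu]_t (H (p, t))%:E)%E).
  rewrite /Rintegral; congr fine; apply: ae_eq_integral => //.
  - apply/measurable_EFinP; apply: measurable_funM => //.
    exact: measurable_average.
  - exact: (measurable_fubini_F iH).
rewrite (Fubini iH) [RHS]Rintegral_mkcond /Rintegral; congr fine.
apply: eq_integral => t _; rewrite patchE.
have iphiz : lambda.-integrable setT
    (EFin \o (fun p => phi p * z (p + (s * t) *: ebase R i))).
  apply: sqint_mul => //; split.
    exact: (measurableT_comp mz (measurable_shift _)).
  rewrite /sqn (ge0_integral_shift _ (f := fun p => (z p ^+ 2)%:E)).
  - by case: sz.
  - exact: measurable_sqr.
  - by move=> p; rewrite lee_fin sqr_ge0.
transitivity (\int[lambda]_p (((\1_(`[0, h]) t * (1 - t / h))%:E *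
    (phi p * z (p + (s * t) *: ebase R i))%:E)))%E.
  apply: eq_integral => p _; rewrite /H /kernel/= -EFinM; congr _%:E; ring.
rewrite integralZl// indicE; case: (boolP (t \in _)) => _;
  last by rewrite mul0r mul0e.
rewrite mul1r EFinM /Rintegral fineK//; exact: integrable_fin_num.
Qed.

End average.

(** * Adjoint of the average and its action on tensor products *)

Section adjoint.
Context {R : realType}.
Notation mu := (@lebesgue_measure R).
Notation lambda := (@leb2 R).
Notation mR := (measurableTypeR R).
Implicit Types (u w z phi : R * R -> R) (i : 'I_2).

Lemma sqn_shift z (v : R * R) : measurable_fun [set: mR * mR] z ->
  sqn lambda (fun p => z (p + v)) = sqn lambda z.
Proof.
move=> mz; rewrite /sqn (ge0_integral_shift _ (f := fun p => (z p ^+ 2)%:E))//.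
- exact: measurable_sqr.
- by move=> p; rewrite lee_fin sqr_ge0.
Qed.

Lemma sqint_shift z (v : R * R) :
  sqint lambda z -> sqint lambda (fun p => z (p + v)).
Proof.
move=> [mz nz]; split; last by rewrite sqn_shift.
exact: (measurableT_comp mz (measurable_shift _)).
Qed.

Lemma Rintegral_mul_shift phi z (v : R * R) :
  measurable_fun [set: mR * mR] phi -> measurable_fun [set: mR * mR] z ->
  \int[lambda]_p (phi p * z (p + v)) = \int[lambda]_p (z p * phi (p - v)).
Proof.
move=> mphi mz; rewrite /Rintegral; congr fine.
rewrite -[RHS](integral_shift v); last first.
  apply/measurable_EFinP; apply: measurable_funM => //.
  exact: (measurableT_comp mphi (measurable_shift _)).
by apply: eq_integral => p _; rewrite addrK mulrC.
Qed.

(** Each translation is adjoint to the opposite one, and [integral_average] superposes these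
    identities over [t] on both sides. *)
Lemma average_adjoint i (s h : R) phi z : 0 < h ->
  sqint lambda phi -> sqint lambda z ->
  \int[lambda]_p (phi p * average i s h z p) =
  \int[lambda]_p (z p * average i (- s) h phi p).
Proof.
move=> h0 sphi sz.
rewrite (integral_average _ h0 _ sphi sz) (integral_average _ h0 _ sz sphi).
apply: eq_Rintegral => t _.
rewrite Rintegral_mul_shift; [|by case: sphi|by case: sz].
by congr (_ * _); apply: eq_Rintegral => p _; rewrite mulNr scaleNr.
Qed.

Lemma continuous_support_bounded (c : R -> R) (a b : R) : continuous c ->
  (forall x, ~ (x \in `[a, b]) -> c x = 0) -> exists M, forall x, `|c x| <= M.
Proof.
move=> cc c0.
have /compact_bounded : compact (c @` `[a, b]).
  apply: continuous_compact; last exact: segment_compact.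
  exact: continuous_subspaceT.
move=> /pinfty_ex_gt0[M M0 cM]; exists M => x.
have [xab|/c0 ->] := pselect (x \in `[a, b]); last by rewrite normr0 ltW.
by apply: cM; exists x.
Qed.

Lemma sqint_tens i (c d : R -> R) (a1 b1 a2 b2 : R) : continuous c -> continuous d ->
  (forall x, ~ (x \in `[a1, b1]) -> c x = 0) ->
  (forall x, ~ (x \in `[a2, b2]) -> d x = 0) ->
  sqint lambda (tens i c d).
Proof.
move=> cc cd c0 d0.
have H (e f : R -> R) (a b a' b' : R) : continuous e -> continuous f ->
    (forall x, ~ (x \in `[a, b]) -> e x = 0) ->
    (forall x, ~ (x \in `[a', b']) -> f x = 0) ->
    sqint lambda (fun p => e p.1 * f p.2).
  move=> ce cf e0 f0.
  have [M eM] := continuous_support_bounded ce e0.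
  have [N fN] := continuous_support_bounded cf f0.
  pose B : set (mR * mR) := `[a, b] `*` `[a', b'].
  apply: (@sqint_bounded_support _ _ _ _ _ B (M * N)).
  - by apply: measurableX; exact: measurable_itv.
  - have fin (x y : R) : (mu `[x, y]%classic < +oo)%E.
      by rewrite lebesgue_measure_itv/=; case: ifP; rewrite ?ltry.
    rewrite /= /leb2 product_measure1E; [|exact: measurable_itv..].
    rewrite lte_mul_pinfty ?measure_ge0//; last exact: fin.
    by rewrite ge0_fin_numE ?measure_ge0//; exact: fin.
  - apply: measurable_funM.
      have me : measurable_fun [set: mR] e by exact: continuous_measurable_fun.
      exact: (measurableT_comp me measurable_fst).
    have mf : measurable_fun [set: mR] f by exact: continuous_measurable_fun.
    exact: (measurableT_comp mf measurable_snd).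
  - move=> p; rewrite normrM; exact: ler_pM.
  - move=> p /not_andP[p1|p2]; first by rewrite e0// mul0r.
    by rewrite f0 ?mulr0.
rewrite /tens; case: (eqVneq i 0) => _; first exact: (H _ _ a1 b1 a2 b2).
exact: (H _ _ a2 b2 a1 b1).
Qed.

Lemma tens_shift i (c d : R -> R) (r : R) p :
  tens i c d (p + r *: ebase R i) = tens i (fun x => c (x + r)) d p.
Proof.
rewrite /tens /ebase; case: (eqVneq i 0) => _ /=.
  by rewrite /GRing.scale/= mulr1 mulr0 addr0.
by rewrite /GRing.scale/= mulr1 mulr0 addr0.
Qed.

(** This recognizes Phi (x) d as an average of c (x) d, so that [average_adjoint] can move it onto
    [z]. *)
Lemma tens_average i (c d : R -> R) (s h : R) p : continuous c ->
  tens i (fun y => \int[mu]_(t in `[0, h]) ((1 - t / h) * c (y - s * t))) d p =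
  average i (- s) h (tens i c d) p.
Proof.
move=> cc; rewrite /average.
have ik y : mu.-integrable `[0, h]
    (EFin \o (fun t => (1 - t / h) * c (y - s * t))).
  apply: continuous_compact_integrable; first exact: segment_compact.
  apply: continuous_subspaceT => t; apply: cvgM.
    apply: cvgB; first exact: cvg_cst.
    by apply: cvgM; [exact: cvg_id|exact: cvg_cst].
  apply: (@continuous_comp _ _ _ (fun t => y - s * t) c); last exact: cc.
  apply: cvgB; first exact: cvg_cst.
  by apply: cvgM; [exact: cvg_cst|exact: cvg_id].
under [RHS]eq_Rintegral do rewrite tens_shift.
rewrite /tens; case: (eqVneq i 0) => _.
  rewrite -RintegralZr//; apply: eq_Rintegral => t _.
  by rewrite mulNr mulrA.
rewrite -RintegralZl//; apply: eq_Rintegral => t _.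
by rewrite mulNr mulrCA.
Qed.

End adjoint.

(** * Taylor formula for weak derivatives *)

Section representation.
Context {R : realType}.
Notation mu := (@lebesgue_measure R).
Notation lambda := (@leb2 R).
Notation mR := (measurableTypeR R).

Variables (i : 'I_2) (u w z : R * R -> R) (s h : R).
Hypotheses (su : sqint lambda u) (sw : sqint lambda w) (sz : sqint lambda z).
Hypotheses (ss : s * s = 1) (h0 : 0 < h).
Hypothesis Dw : forall phi, test_function Omega phi ->
  \int[lambda]_p (u p * 'D_(ebase R i) phi p) = - \int[lambda]_p (w p * phi p).
Hypothesis Dz : forall phi, test_function Omega phi ->
  \int[lambda]_p (w p * 'D_(ebase R i) phi p) = - \int[lambda]_p (z p * phi p).

Let defect p : R := w p + (s / h) * (u p - u (p + (s * h) *: ebase R i)) +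
  s * average i s h z p.

(** The supports of Phi and psi lie in the hull of the support of [c] and its translate by [s * h];
    the min and max treat [s = 1] and [s = -1] together. *)
Let segment_shift (a b y t : R) : 0 <= t <= h ->
  ~ (y \in `[Num.min a (a + s * h), Num.max b (b + s * h)]) ->
  ~ (y - s * t \in `[a, b]).
Proof.
move=> /andP[t0 th] /negP; rewrite in_itv/= negb_and -!ltNge => H.
rewrite in_itv/= => /andP[ya yb]; move: H.
have /orP[/eqP s1|/eqP s1] : (s == 1) || (s == -1).
- by rewrite -sqrf_eq1 expr2 ss.
- by rewrite s1 lt_min gt_max; move: ya yb; rewrite s1 => ya yb /orP[]/andP[]; lra.
- by rewrite s1 lt_min gt_max; move: ya yb; rewrite s1 => ya yb /orP[]/andP[]; lra.
Qed.

(** The integral of [w] against psi (x) d occurs in both weak formulations and is eliminated between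
    them. *)
Lemma integral_defect_tens (c d : R -> R) (a1 b1 a2 b2 : R) :
  smooth c -> smooth d ->
  (forall x, ~ (x \in `[a1, b1]) -> c x = 0) ->
  (forall x, ~ (x \in `[a2, b2]) -> d x = 0) ->
  (if i == 0 then 0 < a2 /\ b2 < 1
   else 0 < Num.min a1 (a1 + s * h) /\ Num.max b1 (b1 + s * h) < 1) ->
  \int[lambda]_p (defect p * tens i c d p) = 0.
Proof.
move=> sc sd c0 d0 ab.
have cvanish : exists a, forall x, x <= a -> c x = 0.
  exists (a1 - 1) => x xa; apply: c0; rewrite in_itv/= => /andP[]; lra.
pose Phi y := \int[mu]_(t in `[0, h]) ((1 - t / h) * c (y - s * t)).
pose psi y := h^-1 * \int[mu]_(t in `[0, h]) c (y - s * t).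
have [sPhi dPhi spsi dpsi] : [/\ smooth Phi,
    forall y : R, is_derive y 1 Phi (s * (c y - psi y)), smooth psi &
    forall y : R, is_derive y 1 psi (s / h * (c y - c (y - s * h)))].
  exact: smooth_kernel.
have cshift y t : ~ (y \in `[Num.min a1 (a1 + s * h), Num.max b1 (b1 + s * h)]) ->
    t \in `[0, h]%classic -> c (y - s * t) = 0.
  by move=> yab; rewrite inE/= in_itv/= => t0h; apply/c0/segment_shift.
have Phi0 y : ~ (y \in `[Num.min a1 (a1 + s * h), Num.max b1 (b1 + s * h)]) ->
    Phi y = 0.
  move=> yab; rewrite /Phi (@eq_Rintegral _ _ _ _ _ (cst 0)).
    by rewrite Rintegral_cst// mul0r.
  by move=> t t0h; rewrite cshift// mulr0.
have psi0 y : ~ (y \in `[Num.min a1 (a1 + s * h), Num.max b1 (b1 + s * h)]) ->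
    psi y = 0.
  move=> yab; rewrite /psi (@eq_Rintegral _ _ _ _ _ (cst 0)).
    by rewrite Rintegral_cst// mul0r mulr0.
  by move=> t t0h; rewrite cshift.
have tPhi : test_function Omega (tens i Phi d).
  exact: test_function_tens sPhi sd Phi0 d0 ab.
have tpsi : test_function Omega (tens i psi d).
  exact: test_function_tens spsi sd psi0 d0 ab.
have cc := smooth_continuous sc; have cd := smooth_continuous sd.
have sphi : sqint lambda (tens i c d) by exact: sqint_tens cc cd c0 d0.
have spsid : sqint lambda (tens i psi d).
  exact: sqint_tens (smooth_continuous spsi) cd psi0 d0.
have iphi f : sqint lambda f ->
  lambda.-integrable setT (EFin \o (fun p => f p * tens i c d p)).
  by move=> sf; exact: sqint_mul.
have iw := iphi _ sw; have iu := iphi _ su.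
have iuh := iphi _ (sqint_shift ((s * h) *: ebase R i) su).
have iz := iphi _ (sqint_average i h0 s sz).
have iwpsi : lambda.-integrable setT (EFin \o (fun p => w p * tens i psi d p)).
  exact: sqint_mul.
set phi := tens i c d in sphi iphi iw iu iuh iz *.
(* Equation for [z] tested with Phi (x) d, followed by adjointness. *)
have E1 : s * (\int[lambda]_p (w p * phi p) -
    \int[lambda]_p (w p * tens i psi d p)) =
  - \int[lambda]_p (average i s h z p * phi p).
  rewrite -RintegralB// -RintegralZl//; last exact: (integrableB measurableT iw iwpsi).
  transitivity (\int[lambda]_p (w p * 'D_(ebase R i) (tens i Phi d) p)).
    apply: eq_Rintegral => p _; have [_ ->] := is_derive_tens i d p dPhi.
    by rewrite /phi /tens; case: ifP => _; ring.
  rewrite (Dz tPhi); congr (- _).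
  under [RHS]eq_Rintegral => p _ do rewrite mulrC.
  rewrite average_adjoint//.
  by apply: eq_Rintegral => p _; rewrite tens_average.
(* Equation for [w] tested with psi (x) d, followed by a translation. *)
have E2 : s / h * (\int[lambda]_p (u p * phi p) -
    \int[lambda]_p (u (p + (s * h) *: ebase R i) * phi p)) =
  - \int[lambda]_p (w p * tens i psi d p).
  rewrite -(Dw tpsi).
  have -> : \int[lambda]_p (u (p + (s * h) *: ebase R i) * phi p) =
      \int[lambda]_p (u p * phi (p - (s * h) *: ebase R i)).
    rewrite -(Rintegral_mul_shift _ _); [|by case: sphi|by case: su].
    by apply: eq_Rintegral => p _; rewrite mulrC.
  have iuh' : lambda.-integrable setT
      (EFin \o (fun p => u p * phi (p - (s * h) *: ebase R i))).
    by apply: sqint_mul => //; exact: sqint_shift.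
  rewrite -RintegralB// -RintegralZl//; last exact: (integrableB measurableT iu iuh').
  apply: eq_Rintegral => p _; have [_ ->] := is_derive_tens i d p dpsi.
  rewrite /phi -[- (_ *: ebase R i)]scaleNr tens_shift.
  by rewrite /tens; case: ifP => _ /=; ring.
transitivity (\int[lambda]_p (w p * phi p) +
  s / h * (\int[lambda]_p (u p * phi p) -
    \int[lambda]_p (u (p + (s * h) *: ebase R i) * phi p)) +
  s * \int[lambda]_p (average i s h z p * phi p)).
  have iB := integrableB measurableT iu iuh.
  have iZ := integrableZl measurableT (s / h) iB.
  have iD := integrableD measurableT iw iZ.
  rewrite -RintegralB// -RintegralZl// -RintegralZl// -RintegralD// -RintegralD//.
    by apply: eq_Rintegral => p _; rewrite /defect; ring.
  exact: (integrableZl measurableT s iz).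
(* What remains is A - B + s C, and [E1] multiplied by [s] says s C = -(A - B). *)
rewrite E2; move: E1; set A := \int[lambda]_p _; set B := \int[lambda]_p _.
set C := \int[lambda]_p _ => E1.
have -> : s * C = - (s * s * (A - B)) by rewrite -mulrA E1 mulrN opprK.
by rewrite ss; ring.
Qed.

Let measurable_defect : measurable_fun [set: mR * mR] defect.
Proof.
have mu' := (sqint_shift ((s * h) *: ebase R i) su).1.
apply: measurable_funD; last first.
  by apply: measurable_funM => //; apply: measurable_average; case: sz.
apply: measurable_funD; first by case: sw.
apply: measurable_funM => //.
by apply: measurable_funB => //; case: su.
Qed.

Let integrable_defect (D : set (mR * mR)) : measurable D -> (lambda D < +oo)%E ->
  lambda.-integrable D (EFin \o defect).
Proof.
move=> mD fD.
have iw := sqint_integrable_fin mD fD sw.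
have iu := sqint_integrable_fin mD fD su.
have iuh := sqint_integrable_fin mD fD (sqint_shift ((s * h) *: ebase R i) su).
have iz := sqint_integrable_fin mD fD (sqint_average i h0 s sz).
exact: (integrableD mD (integrableD mD iw (integrableZl mD (s / h)
  (integrableB mD iu iuh))) (integrableZl mD s iz)).
Qed.

Let box_bump (x1 x2 y1 y2 : R) n (p : R * R) : R :=
  cutoff x1 x2 n p.1 * cutoff y1 y2 n p.2.

Let box_bump_le (x1 x2 y1 y2 : R) n (p : R * R) :
  `|box_bump x1 x2 y1 y2 n p| <= \1_(`]x1, x2[ `*` `]y1, y2[) p.
Proof.
rewrite /box_bump.
have /andP[f0 _] := cutoff_itv x1 x2 n p.1.
have /andP[g0 _] := cutoff_itv y1 y2 n p.2.
rewrite ger0_norm; last exact: mulr_ge0 f0 g0.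
have := ler_pM f0 g0 (cutoff_indic_le x1 x2 n p.1) (cutoff_indic_le y1 y2 n p.2).
move=> /le_trans; apply; rewrite !indicE.
case: (boolP (p.1 \in _)) => [|_]; last by rewrite mul0r.
case: (boolP (p.2 \in _)) => [|_]; last by rewrite mulr0.
by rewrite !inE => p2 p1; rewrite mem_set ?mulr1.
Qed.

Let cvg_box_bump (x1 x2 y1 y2 : R) (p : R * R) :
  box_bump x1 x2 y1 y2 n p @[n --> \oo] -->
    (\1_(`]x1, x2[ `*` `]y1, y2[) p : R).
Proof.
have -> : \1_(`]x1, x2[ `*` `]y1, y2[) p =
    \1_(`]x1, x2[) p.1 * \1_(`]y1, y2[) p.2 :> R.
  rewrite !indicE; case: (boolP (p \in _)).
    by rewrite inE => -[p1 p2]; rewrite !mem_set ?mulr1.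
  rewrite notin_setE => /not_andP[np|np]; first by rewrite memNset// mul0r.
  by rewrite [p.2 \in _]memNset// mulr0.
by apply: cvgM; exact: cvg_cutoff.
Qed.

Let measurable_box_bump (x1 x2 y1 y2 : R) n :
  measurable_fun [set: mR * mR] (box_bump x1 x2 y1 y2 n).
Proof.
have mb (x y : R) : measurable_fun [set: mR] (cutoff x y n).
  by apply: continuous_measurable_fun; exact/smooth_continuous/smooth_cutoff.
apply: measurable_funM.
  exact: (measurableT_comp (mb x1 x2) measurable_fst).
exact: (measurableT_comp (mb y1 y2) measurable_snd).
Qed.

Variables a b : R.
Hypotheses (a0 : 0 <= a) (b1 : b <= 1).
Hypothesis abh : i != 0 -> 0 <= a + s * h /\ b + s * h <= 1.

(** The margin 1/(n+1) of the cutoffs turns the non-strict bounds on the band and on its shift into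
    the strict ones required of supports. *)
Let integral_defect_bump (x1 x2 y1 y2 : R) n : a <= y1 -> y2 <= b ->
  \int[lambda]_p (defect p * box_bump x1 x2 y1 y2 n p) = 0.
Proof.
move=> ay yb; have e0 : 0 < n.+1%:R^-1 :> R by rewrite invr_gt0.
have [i0|i0] := eqVneq i 0.
  have := @integral_defect_tens (cutoff x1 x2 n) (cutoff y1 y2 n) _ _ _ _
    (smooth_cutoff x1 x2 n) (smooth_cutoff y1 y2 n)
    (@cutoff_eq0 _ x1 x2 n) (@cutoff_eq0 _ y1 y2 n).
  rewrite /tens i0 eqxx; apply; split; first exact: ltr_wpDl (le_trans a0 ay) e0.
  by rewrite ltrBlDr (le_lt_trans (le_trans yb b1))// ltrDl.
have [lo hi] := abh i0.
have := @integral_defect_tens (cutoff y1 y2 n) (cutoff x1 x2 n) _ _ _ _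
  (smooth_cutoff y1 y2 n) (smooth_cutoff x1 x2 n)
  (@cutoff_eq0 _ y1 y2 n) (@cutoff_eq0 _ x1 x2 n).
have shy x y : x <= y -> x + s * h <= y + s * h by rewrite lerD2r.
rewrite /tens (negbTE i0); apply; rewrite lt_min gt_max !(addrAC _ _ (s * h)).
rewrite !ltr_wpDl ?(le_trans a0 ay) ?(le_trans lo (shy _ _ ay))//.
split=> //; rewrite !ltrBlDr; apply/andP; split.
  by rewrite (le_lt_trans (le_trans yb b1))// ltrDl.
by rewrite (le_lt_trans (le_trans (shy _ _ yb) hi))// ltrDl.
Qed.

(** The bumps converge to the indicator of a box and are dominated by it, so the integral of
    [defect] over every box in the band is zero by dominated convergence. *)
Lemma weak_derivative_representation :
  {ae lambda, forall p, a < p.2 < b ->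
    w p = (s / h) * (u (p + (s * h) *: ebase R i) - u p) -
      s * average i s h z p}.
Proof.
have fin_box (x1 x2 y1 y2 : R) : (lambda (`]x1, x2[ `*` `]y1, y2[) < +oo)%E.
  have fin (x y : R) : (mu `]x, y[%classic < +oo)%E.
    by rewrite lebesgue_measure_itv/=; case: ifP; rewrite ?ltry.
  rewrite /= /leb2 product_measure1E; [|exact: measurable_itv..].
  rewrite lte_mul_pinfty ?measure_ge0//; last exact: fin.
  by rewrite ge0_fin_numE ?measure_ge0//; exact: fin.
have mbox (x1 x2 y1 y2 : R) : measurable (`]x1, x2[ `*` `]y1, y2[ : set (mR * mR)).
  by apply: measurableX; exact: measurable_itv.
suff : {ae lambda, forall p, a < p.2 < b -> defect p = 0}.
  apply: filterS; first exact: (ae_filter_ringOfSetsType lambda).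
  move=> p /[apply]; rewrite /defect => dp.
  rewrite -[LHS]subr0 -dp; ring.
apply: ae_eq0_integral_box => [n|x1 x2 y1 y2 ay yb]; first exact: integrable_defect.
set B : set (mR * mR) := _ `*` _.
have mB : measurable B := mbox _ _ _ _.
have iB : lambda.-integrable setT (EFin \o (fun p => defect p * \1_B p)).
  have := (@integrable_mkcond _ _ _ lambda B (EFin \o defect) mB).1
    (integrable_defect mB (fin_box _ _ _ _)).
  apply: eq_integrable => // p _; rewrite patchE /= indicE.
  by case: ifPn => _; rewrite ?mulr1 ?mulr0.
have bound n p : (`|(defect p * box_bump x1 x2 y1 y2 n p)%:E| <=
    `|(defect p * \1_B p)%:E|)%E.
  rewrite lee_fin normrM [leRHS]normrM ler_wpM2l//.
  by apply: le_trans (box_bump_le _ _ _ _ _ _) _; exact: ler_norm.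
have mn n : measurable_fun setT
    (fun p : mR * mR => (defect p * box_bump x1 x2 y1 y2 n p)%:E).
  apply/measurable_EFinP.
  exact: (measurable_funM measurable_defect (measurable_box_bump x1 x2 y1 y2 n)).
have [||_ _ cv] := @dominated_convergence _ _ _ lambda setT measurableT _
  (fun p => (defect p * \1_B p)%:E) (fun p => `|(defect p * \1_B p)%:E|%E)
  mn (measurable_int _ iB) _ (integrable_abse iB).
- apply: aeW => p _; apply: cvg_EFin; first exact: nearW.
  by apply: cvgM; [exact: cvg_cst|exact: cvg_box_bump].
- by apply: aeW => p n _; exact: bound.
have <- : (\int[lambda]_p (defect p * \1_B p)%:E =
    \int[lambda]_(p in B) (defect p)%:E)%E.
  rewrite [RHS]integral_mkcond; apply: eq_integral => p _.
  by rewrite patchE indicE; case: ifPn => _; rewrite ?mulr1 ?mulr0.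
move: cv => /cvg_lim <-//.
rewrite (_ : (fun n => _) = cst 0%E) ?lim_cst//; apply/funext => n /=.
have := integral_defect_bump x1 x2 n ay yb; rewrite /Rintegral => H.
rewrite -[LHS]fineK ?H//; apply: integrable_fin_num => //.
by apply: le_integrable iB => // p _; exact: bound.
Qed.

End representation.

(** * Interpolation inequality *)

Section interpolation.
Context {R : realType}.
Notation mu := (@lebesgue_measure R).
Notation lambda := (@leb2 R).
Notation mR := (measurableTypeR R).

Section interpolation_tests.
Variables (i : 'I_2) (u w z : R * R -> R) (h : R).
Hypotheses (su : sqint lambda u) (sw : sqint lambda w) (sz : sqint lambda z).
Hypothesis h0 : 0 < h.
Hypothesis Dw : forall phi, test_function Omega phi ->
  \int[lambda]_p (u p * 'D_(ebase R i) phi p) = - \int[lambda]_p (w p * phi p).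
Hypothesis Dz : forall phi, test_function Omega phi ->
  \int[lambda]_p (w p * 'D_(ebase R i) phi p) = - \int[lambda]_p (z p * phi p).

Let strip (a b : R) : set (mR * mR) := [set p | a < p.2 < b].

Let measurable_strip a b : measurable (strip a b).
Proof.
rewrite (_ : strip a b = [set: mR] `*` `]a, b[).
  by apply: measurableX => //; exact: measurable_itv.
by apply/seteqP; split=> p /=; rewrite in_itv/= => // -[].
Qed.

Lemma integral_strip_le (s a b : R) : s * s = 1 -> 0 <= a -> b <= 1 ->
  0 <= a + s * h -> b + s * h <= 1 ->
  (\int[lambda]_(p in strip a b) (w p ^+ 2)%:E <=
   (6 / h ^+ 2)%:E * sqn lambda u + (3 * h ^+ 2)%:E * sqn lambda z)%E.
Proof.
move=> ss a0 b1 ah bh.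
have rep := weak_derivative_representation su sw sz ss h0 Dw Dz a0 b1
  (fun=> conj ah bh).
pose v := (s * h) *: ebase R i.
have [muh _] := sqint_shift v su.
have [mav _] := sqint_average i h0 s sz.
have [mu0 _] := su.
pose G p : \bar R := ((3 / h ^+ 2)%:E * ((u (p + v)) ^+ 2)%:E +
  (3 / h ^+ 2)%:E * ((u p) ^+ 2)%:E + 3%:E * ((average i s h z p) ^+ 2)%:E)%E.
have c0 : 0 <= 3 / h ^+ 2 by rewrite divr_ge0// sqr_ge0.
have mG1 : measurable_fun [set: mR * mR]
    (fun p => (3 / h ^+ 2)%:E * ((u (p + v)) ^+ 2)%:E)%E.
  by apply: measurable_funeM; exact: measurable_sqr.
have mG2 : measurable_fun [set: mR * mR]
    (fun p => (3 / h ^+ 2)%:E * ((u p) ^+ 2)%:E)%E.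
  by apply: measurable_funeM; exact: measurable_sqr.
have mG3 : measurable_fun [set: mR * mR]
    (fun p => 3%:E * ((average i s h z p) ^+ 2)%:E)%E.
  by apply: measurable_funeM; exact: measurable_sqr.
have G1 p : (0 <= (3 / h ^+ 2)%:E * ((u (p + v)) ^+ 2)%:E)%E.
  by rewrite mule_ge0// lee_fin// sqr_ge0.
have G2 p : (0 <= (3 / h ^+ 2)%:E * ((u p) ^+ 2)%:E)%E.
  by rewrite mule_ge0// lee_fin// sqr_ge0.
have G3 p : (0 <= 3%:E * ((average i s h z p) ^+ 2)%:E)%E.
  by rewrite mule_ge0// lee_fin// sqr_ge0.
have mG : measurable_fun [set: mR * mR] G.
  by apply: emeasurable_funD => //; exact: emeasurable_funD.
have G0 p : (0 <= G p)%E by rewrite /G !adde_ge0.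
apply: (@le_trans _ _ (\int[lambda]_(p in strip a b) G p)%E).
  apply: ae_ge0_le_integral => //.
  - by move=> p _; rewrite lee_fin sqr_ge0.
  - by apply: measurable_funTS; apply: measurable_sqr; case: sw.
  - exact: measurable_funTS.
  move: rep; apply: filterS; first exact: (ae_filter_ringOfSetsType lambda).
  move=> p /[apply] ->; rewrite /G -!EFinM -!EFinD lee_fin.
  rewrite -/v; set U := u (p + v); set V := u p; set A := average _ _ _ _ _.
  have -> : (s / h * (U - V) - s * A) ^+ 2 = (s * s) * ((U / h - V / h) - A) ^+ 2.
    by ring.
  rewrite ss mul1r.
  have -> : 3 / h ^+ 2 * U ^+ 2 = 3 * (U / h) ^+ 2 by field; rewrite gt_eqF.
  have -> : 3 / h ^+ 2 * V ^+ 2 = 3 * (V / h) ^+ 2 by field; rewrite gt_eqF.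
  set x := U / h; set y := V / h.
  (* These three squares add up to 3 (x^2 + y^2 + A^2) - (x - y - A)^2. *)
  have := sqr_ge0 (x + y); have := sqr_ge0 (x + A); have := sqr_ge0 (y - A).
  nra.
apply: (@le_trans _ _ (\int[lambda]_p G p)%E).
  by apply: ge0_subset_integral.
have Zk (f : R * R -> R) (k : R) : measurable_fun [set: mR * mR] f -> 0 <= k ->
    (\int[lambda]_p (k%:E * (f p ^+ 2)%:E) = k%:E * sqn lambda f)%E.
  move=> mf k0; have mf2 := measurable_sqr mf.
  by rewrite ge0_integralZl_EFin// => p _; rewrite lee_fin sqr_ge0.
rewrite /G ge0_integralD//; first last.
- exact: emeasurable_funD.
- by move=> p _; rewrite adde_ge0.
rewrite ge0_integralD// !Zk// (sqn_shift v mu0) -ge0_muleDl ?lee_fin// -EFinD.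
rewrite (_ : 3 / h ^+ 2 + 3 / h ^+ 2 = 6 / h ^+ 2); last by ring.
rewrite leeD2l// EFinM -muleA lee_pmul2l ?lte_fin//.
by apply: sqn_average_le => //; case: sz.
Qed.

Lemma weak_interpolation : h <= 3^-1 -> (forall p, ~ Omega p -> w p = 0) ->
  (sqn lambda w <=
   (12 / h ^+ 2)%:E * sqn lambda u + (6 * h ^+ 2)%:E * sqn lambda z)%E.
Proof.
move=> h3 w0.
pose X := ((6 / h ^+ 2)%:E * sqn lambda u + (3 * h ^+ 2)%:E * sqn lambda z)%E.
have e1 : 0 <= 0 + 1 * h by have := h0; lra.
have e2 : 2 / 3 + 1 * h <= 1 by have := h0; lra.
have e3 : 0 <= 1 / 3 + -1 * h by have := h0; lra.
have e4 : 1 + -1 * h <= 1 by have := h0; lra.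
have e5 : 2 / 3 <= 1 :> R by lra.
have e6 : 0 <= 1 / 3 :> R by lra.
have lo : (\int[lambda]_(p in strip 0 (2 / 3)) (w p ^+ 2)%:E <= X)%E.
  exact: integral_strip_le (mulr1 1) (lexx 0) e5 e1 e2.
have hi : (\int[lambda]_(p in strip (1 / 3) 1) (w p ^+ 2)%:E <= X)%E.
  by apply: integral_strip_le _ e6 (lexx 1) e3 e4; rewrite mulrNN mulr1.
have mw2 : measurable_fun [set: mR * mR] (fun p => (w p ^+ 2)%:E).
  by apply: measurable_sqr; case: sw.
have w2 p : (0 <= (w p ^+ 2)%:E)%E by rewrite lee_fin sqr_ge0.
(* The two strips cover [Omega]; their overlap is counted twice, which only increases the sum, and
   [w] vanishes off [Omega]. *)
apply: (@le_trans _ _ (\int[lambda]_(p in strip 0 (2 / 3)) (w p ^+ 2)%:E +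
  \int[lambda]_(p in strip (1 / 3) 1) (w p ^+ 2)%:E)%E).
  rewrite [X in (X + _)%E]integral_mkcond [X in (_ + X)%E]integral_mkcond.
  have m1 : measurable_fun setT ((fun p => (w p ^+ 2)%:E) \_ (strip 0 (2 / 3))).
    by apply/(measurable_restrictT _ (measurable_strip _ _)); exact: measurable_funTS.
  have m2 : measurable_fun setT ((fun p => (w p ^+ 2)%:E) \_ (strip (1 / 3) 1)).
    by apply/(measurable_restrictT _ (measurable_strip _ _)); exact: measurable_funTS.
  have r0 (D : set (mR * mR)) p : (0 <= ((fun p => (w p ^+ 2)%:E) \_ D) p)%E.
    by rewrite patchE; case: ifP.
  rewrite -ge0_integralD//; apply: ge0_le_integral => //.
    exact: emeasurable_funD.
  move=> p _; have [Op|/w0 wp0] := pselect (Omega p); last first.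
    by rewrite wp0 expr0n adde_ge0.
  have /andP[p0 p1] : 0 < p.2 < 1 := Op.
  have [p2|p2] := ltP p.2 (2 / 3).
    by rewrite [X in (_ <= X + _)%E]patchE mem_set ?leeDl//= /strip/= p0.
  rewrite [X in (_ <= _ + X)%E]patchE mem_set ?leeDr//= /strip/= p1 andbT; lra.
apply: le_trans (leeD lo hi) _; rewrite /X addeACA.
have c0 : 0 <= 6 / h ^+ 2 by rewrite divr_ge0// sqr_ge0.
have d0 : 0 <= 3 * h ^+ 2 by rewrite mulr_ge0// sqr_ge0.
rewrite -!ge0_muleDl ?lee_fin// -!EFinD.
rewrite le_eqVlt; apply/orP; left; apply/eqP.
by congr (_%:E * _ + _%:E * _)%E; ring.
Qed.

End interpolation_tests.
End interpolation.

(** Here [q] stands for h^2, hence the limit 1/9, and [A], [B], [C] for the squared norms of [u],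
    its gradient and its second gradient. The balancing value q = sqrt (A / C) is admissible exactly
    when 81 A <= C, for positive [A] and [C]. *)
Lemma optimize_scale (R : realType) (A B C : R) : 0 <= A -> 0 <= B -> 0 <= C ->
  (forall q, 0 < q -> q <= 9^-1 -> B <= 24 * (A / q) + 6 * (q * C)) ->
  B <= 30 * Num.sqrt A * Num.sqrt (B + C).
Proof.
move=> A0 B0 C0 H.
have B2 : B ^+ 2 <= (30 ^+ 2) * (A * (B + C)).
  have [CA|AC] := leP C (81 * A).
    (* The largest scale gives B <= 216 A + (2/3) C <= 270 A. The bound on B^2 is then paid for by
       the term [A * B], that is, by the lower-order part of the H^1 norm. *)
    have := H 9^-1; rewrite invrK => /(_ _ (lexx _)) => /(_ ltac:(lra)) HB.
    have {}HB : B <= 270 * A by lra.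
    have : 0 <= A * C by exact: mulr_ge0.
    have : 0 <= A * B by exact: mulr_ge0.
    have : B * B <= 270 * A * B by exact: ler_wpM2r.
    rewrite !expr2; lra.
  have Cpos : 0 < C by lra.
  have [A00|An0] := eqVneq A 0.
    have [->|Bn0] := eqVneq B 0.
      by rewrite expr0n mulr_ge0// ?sqr_ge0// mulr_ge0// addr_ge0.
    have Bpos : 0 < B by rewrite lt_neqAle eq_sym Bn0.
    (* With A = 0 the balancing value degenerates to 0. This small positive [q] gives B <= 6 q C <=
       B / 2, a contradiction. *)
    pose q := Num.min 9^-1 (B / (12 * C)).
    have q0 : 0 < q by rewrite lt_min divr_gt0 ?mulr_gt0//; lra.
    have q9 : q <= 9^-1 by rewrite ge_min lexx.
    have qB : q * C <= B / 12.
      have : q <= B / (12 * C) by rewrite ge_min lexx orbT.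
      move=> /(ler_wpM2r C0); congr (_ <= _); field; lra.
    have := H q q0 q9; rewrite A00 mul0r mulr0 add0r; lra.
  have Apos : 0 < A by rewrite lt_neqAle eq_sym An0.
  pose x := Num.sqrt A; pose y := Num.sqrt C.
  have x0 : 0 < x by rewrite sqrtr_gt0.
  have y0 : 0 < y by rewrite sqrtr_gt0.
  have xA : A = x ^+ 2 by rewrite sqr_sqrtr.
  have yC : C = y ^+ 2 by rewrite sqr_sqrtr.
  have xy : x / y <= 9^-1.
    rewrite ler_pdivrMr// -(@ler_pXn2r _ 2)// ?nnegrE ?ltW//; last first.
      by rewrite mulr_gt0.
    by rewrite exprMn -xA -yC; lra.
  have := H (x / y) (divr_gt0 x0 y0) xy.
  rewrite xA yC.
  have -> : x ^+ 2 / (x / y) = x * y by field; lra.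
  have -> : x / y * y ^+ 2 = x * y by field; lra.
  move=> HB; have {}HB : B <= 30 * (x * y) by lra.
  have : B ^+ 2 <= (30 * (x * y)) ^+ 2.
    by rewrite lerXn2r ?nnegrE// !mulr_ge0// ltW.
  move=> /le_trans; apply.
  rewrite exprMn exprMn. rewrite ler_wpM2l ?sqr_ge0//.
  by rewrite mulrDr lerDr; apply: mulr_ge0 => //; exact: sqr_ge0.
rewrite -mulrA -sqrtrM//.
rewrite -(@ler_pXn2r _ 2)// ?nnegrE//.
by rewrite exprMn sqr_sqrtr// mulr_ge0// addr_ge0.
Qed.

(** * Chosen weak derivatives and norms of tensor fields *)

Section weak_derivatives.
Context {R : realType}.
Notation lambda := (@leb2 R).
Notation mR := (measurableTypeR R).
Implicit Types (f g : R * R -> R).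

Lemma weakDP i f : (exists g, is_weakD i f g) -> is_weakD i f (weakD i f).
Proof. by move=> H; exact: xgetPex. Qed.

(** Passage to extensions by zero, on which translations act. The test functions are still supported
    in [Omega], so a jump across the boundary does no harm. *)
Lemma is_weakD_restrict i f g : is_weakD i f g ->
  forall phi, test_function Omega phi ->
  \int[lambda]_p ((f \_ Omega) p * 'D_(ebase R i) phi p) =
  - \int[lambda]_p ((g \_ Omega) p * phi p).
Proof.
move=> [_ fg] phi tphi; have := fg phi tphi.
rewrite Rintegral_mkcond [X in _ = - X]Rintegral_mkcond => E.
transitivity (\int[lambda]_p ((fun p => f p * 'D_(ebase R i) phi p) \_ Omega) p).
  by apply: eq_Rintegral => p _; rewrite !patchE; case: ifP; rewrite ?mul0r.
rewrite E; congr (- _).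
by apply: eq_Rintegral => p _; rewrite !patchE; case: ifP; rewrite ?mul0r.
Qed.

Lemma L2normv_sqr (I : finType) (F : I -> R * R -> R) : (forall i, L2 (F i)) ->
  (L2normv F ^+ 2 = \sum_i sqn lambda (F i \_ Omega))%E.
Proof.
move=> LF; rewrite /L2normv /L2norm Lnorm2_sqn /sqn -ge0_integral_sum//.
- apply: eq_integral => p _; rewrite sumEFin; congr _%:E.
  under [RHS]eq_bigr do rewrite patchE.
  rewrite patchE; case: ifP => _; last by rewrite expr0n big1.
  by rewrite sqr_sqrtr//; apply: sumr_ge0 => i _; exact: sqr_ge0.
- by move=> i; apply: measurable_sqr; have [] := sqint_Lfun (LF i).
- by move=> i p _; rewrite lee_fin sqr_ge0.
Qed.

Lemma L2_sqn_fin f : L2 f ->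
  sqn lambda (f \_ Omega) = (fine (sqn lambda (f \_ Omega)))%:E.
Proof.
move=> /sqint_Lfun[_ nf]; rewrite fineK// ge0_fin_numE//; exact: sqn_ge0.
Qed.

Lemma L2normv_sqrt (I : finType) (F : I -> R * R -> R) : (forall i, L2 (F i)) ->
  L2normv F = (Num.sqrt (\sum_i fine (sqn lambda (F i \_ Omega))))%:E.
Proof.
move=> LF; have := L2normv_sqr LF.
under eq_bigr do rewrite (L2_sqn_fin (LF _)).
rewrite sumEFin; have : (0 <= L2normv F)%E by exact: Lnorm_ge0.
case: (L2normv F) => [r|//|//]; rewrite lee_fin => r0; rewrite -EFin_expe => -[<-].
by rewrite sqrtr_sqr ger0_norm.
Qed.

End weak_derivatives.

Theorem corollary3p8 (R : realType) (mu k0 k1 : R) (mu_gt0 : 0 < mu) :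
  exists2 C : R, 0 < C &
    forall u : 'I_2 -> R * R -> R, W mu k0 k1 u ->
      (L2normv (grad u) ^+ 2 <= C%:E * L2normv u * H1normv (grad u))%E.
Proof.
exists 30 => // u [_ H2u _].
pose lambda := @leb2 R.
have weakD1 k i : is_weakD i (u k) (weakD i (u k)).
  by apply: weakDP; have [[]] := H2u k.
have weakD2 k i j : is_weakD j (weakD i (u k)) (weakD j (weakD i (u k))).
  by apply: weakDP; have [_ /(_ i)[]] := H2u k.
have L0 k : L2 (u k) by have [[]] := H2u k.
have L1 ki : L2 (grad u ki) by have [] := weakD1 ki.1 ki.2.
have Lg kij : L2 (grad (grad u) kij) by have [] := weakD2 kij.1.1 kij.1.2 kij.2.
pose n f := fine (sqn lambda (f \_ Omega)).
have n0 f : 0 <= n f by rewrite fine_ge0// sqn_ge0.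
pose A := \sum_k n (u k); pose B := \sum_ki n (grad u ki).
pose C := \sum_kij n (grad (grad u) kij).
have A0 : 0 <= A by exact: sumr_ge0.
have B0 : 0 <= B by exact: sumr_ge0.
have C0 : 0 <= C by exact: sumr_ge0.
have sqrB : (L2normv (grad u) ^+ 2 = B%:E)%E.
  rewrite L2normv_sqr//; under eq_bigr do rewrite (L2_sqn_fin (L1 _)).
  by rewrite sumEFin.
have sqrC : (L2normv (grad (grad u)) ^+ 2 = C%:E)%E.
  rewrite L2normv_sqr//; under eq_bigr do rewrite (L2_sqn_fin (Lg _)).
  by rewrite sumEFin.
have H1E : H1normv (grad u) = (Num.sqrt (B + C))%:E.
  transitivity ((B%:E + C%:E) `^ 2^-1)%E; first by rewrite -sqrB -sqrC.
  by rewrite -EFinD poweR_EFin powR12_sqrt//; exact: addr_ge0.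
have L2E : L2normv u = (Num.sqrt A)%:E by exact: L2normv_sqrt.
rewrite sqrB.
rewrite L2E.
rewrite H1E.
rewrite -!EFinM lee_fin.
apply: optimize_scale => // q q0 q9.
(* Applied with h = sqrt q to each component and direction; only the pure second derivative in
   direction [i] appears. *)
have interp k i : n (grad u (k, i)) <=
    12 / q * n (u k) + 6 * q * n (grad (grad u) (k, i, i)).
  have s0 : 0 < Num.sqrt q by rewrite sqrtr_gt0.
  have s3 : Num.sqrt q <= 3^-1.
    have -> : 3^-1 = Num.sqrt (3^-1 ^+ 2) :> R by rewrite sqrtr_sqr ger0_norm.
    by apply: ler_wsqrtr; apply: (le_trans q9); lra.
  have := @weak_interpolation R i _ _ _ _ (sqint_Lfun (L0 k))
    (sqint_Lfun (L1 (k, i))) (sqint_Lfun (Lg (k, i, i))) s0 (is_weakD_restrict (weakD1 k i))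
    (is_weakD_restrict (weakD2 k i i)) s3.
  rewrite (sqr_sqrtr (ltW q0)) (L2_sqn_fin (L0 k)) (L2_sqn_fin (L1 (k, i))).
  rewrite (L2_sqn_fin (Lg (k, i, i))) -!EFinM -EFinD lee_fin; apply.
  by move=> p nOp; rewrite patchE memNset.
have BE : B = \sum_k \sum_i n (grad u (k, i)).
  by rewrite /B [RHS]pair_bigA; apply: eq_bigr => -[].
have CE : C = \sum_k \sum_i \sum_j n (grad (grad u) (k, i, j)).
  transitivity (\sum_ki \sum_j n (grad (grad u) (ki, j))).
    by rewrite pair_bigA; apply: eq_bigr => -[].
  by rewrite [RHS]pair_bigA; apply: eq_bigr => -[].
have SB : B <= \sum_k \sum_(i < 2) (12 / q * n (u k) + 6 * q *
    \sum_j n (grad (grad u) (k, i, j))).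
  rewrite BE; apply: ler_sum => k _; apply: ler_sum => i _.
  apply: le_trans (interp k i) _; rewrite lerD2l ler_wpM2l//.
    by rewrite mulr_ge0// ltW.
  (* The mixed second derivatives are added as nonnegative terms to complete the full second
     gradient. *)
  by rewrite (bigD1 i)//= lerDl; exact: sumr_ge0.
apply: le_trans SB _; rewrite CE.
(* The term in [u k] does not depend on [i], so the sum over two directions turns 12 into 24. *)
under eq_bigr do rewrite big_split/= sumr_const card_ord -mulr_sumr.
rewrite big_split/= sumrMnl -!mulr_sumr -/A.
rewrite le_eqVlt; apply/orP; left; apply/eqP; ring.
Qed.
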